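(* Let $M$, $\omega_M$, $\mathcal{H}$, $\mathcal{V}$, $G$, $\pi:M\to\bar M=M/G$, $D$, $\mathcal{K}^\perp$, $\mathcal{U}$, $\bar{\mathcal H}$, $\omega_{\bar{\mathcal H}}$, $D_{\rm red}$ be as in the context, and assume that $\mathcal{H}\cap\mathcal{V}$ has constant rank on $M$. Then: (i) The generalized distribution $\mathsf{G}_0$ associated to $D$ is trivial, $\mathsf{G}_0=\{0\}$, and the codistribution $\mathsf{P}_1$ associated to $D$ is $\mathsf{P}_1=T^*M$. (ii) For a vector field $X$ on $M$: $X\in\Gamma(\mathcal{U})$ if and only if there exists $\alpha\in\Gamma(\mathcal{V}^\circ)$ such that $(X,\alpha)\in\Gamma(D\cap\mathcal{K}^\perp)$. If in addition $\mathcal{V}+\mathcal{H}=TM$, then this $\alpha$ is unique. (iii) The distributions associated to the reduced Dirac structure $D_{\rm red}$ on $\bar M$ satisfy $\mathsf{G}_1^{\rm red}=\bar{\mathcal{H}}$ and $\mathsf{G}_0^{\rm red}=\{0\}$. (iv) For each $\alpha\in\Gamma(\mathcal{V}^\circ)$ there exists exactly one section $X\in\Gamma(\mathcal{U})$ such that $(X,\alpha)\in\Gamma(D)$. Hence $\pi_2(D\cap\mathcal{K}^\perp)=\mathcal{V}^\circ$, and the reduced codistribution $\mathsf{P}_1^{\rm red}$ equals $T^*(M/G)$. (v) Assume that $\mathsf{G}_1^{\rm red}=\bar{\mathcal{H}}$ has constant rank. Then the $2$-form defined on $\mathsf{G}_1^{\rm red}=\bar{\mathcal{H}}$ by the Dirac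 structure $D_{\rm red}$ is nondegenerate and equal to $\omega_{\bar{\mathcal{H}}}$.
   Context: Conventions. $\Gamma(E)$ denotes smooth local sections of $E$; $\Omega^1(M)$ denotes local $1$-forms. The Pontryagin bundle $TM\oplus T^*M$ carries the pairing $\langle(u,\alpha),(v,\beta)\rangle=\beta(u)+\alpha(v)$; a Dirac structure is a subbundle equal to its orthogonal for this pairing (no integrability is required). For a subbundle $\Delta\subset TM$, $\Delta^\circ\subset T^*M$ is its annihilator. $\pi_2:TM\oplus T^*M\to T^*M$ is the projection. Nonholonomic system. $Q$ is a smooth Riemannian manifold, $L:TQ\to\mathbb{R}$ is the kinetic energy of the metric minus a potential (a function on $Q$), $\mathbb{F}L:TQ\to T^*Q$ its Legendre transformation (a diffeomorphism). $\phi^1,\dots,\phi^k\in\Omega^1(Q)$ are pointwise linearly independent $1$-forms, $\mathcal{D}=\bigcap_j\ker\phi^j\subset TQ$ is the constraint subbundle, and $M:=\mathbb{F}L(\mathcal{D})\subset T^*Q$ is the constraint submanifold, with inclusion $i:M\hookrightarrow T^*Q$. With $\omega_{\rm can}=\sum dq^i\wedge dp_i$ and $\pi_{T^*Q}:T^*Q\to Q$, set $\omega_M:=i^*\omega_{\rm can}$ and $\mathcal{H}:=TM\cap (T\pi_{T^*Q})^{-1}(\mathcal{D})$. It is known that $\mathcal{H}$ is a vector subbundle of $TM$ and that the restriction $\omega_{\mathcal{H}}$ of $\omega_M$ to $\mathcal{H}\times\mathcal{H}$ is nondegenerate. The associated Dirac structure $D$ on $M$ has fibers $$D(m)=\{(X(m),\alpha(m))\mid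 X\in\Gamma(\mathcal{H}),\ \alpha\in\Omega^1(M),\ \alpha-\mathbf{i}_X\omega_M\in\Gamma(\mathcal{H}^\circ)\}.$$ Symmetry. A Lie group $G$ acts symplectically on $T^*Q$, leaves $M$ and $\mathcal{H}$ invariant (hence also $\omega_M$ and $D$), and its action on $M$ is free and proper; $\pi:M\to\bar M:=M/G$ is the quotient map. $\mathcal{V}\subset TM$ is the vertical subbundle (tangent spaces to the $G$-orbits). $\mathcal{K}:=\mathcal{V}\oplus\{0\}$, and $\mathcal{K}^\perp=TM\oplus\mathcal{V}^\circ$. The horizontal annihilator is $\mathcal{U}:=(\mathcal{V}\cap\mathcal{H})^{\omega_M}\cap\mathcal{H}$, where the superscript $\omega_M$ denotes the fiberwise $\omega_M$-orthogonal complement in $TM$. $\bar{\mathcal{H}}:=T\pi(\mathcal{U})\subset T\bar M$. The restriction of $\omega_M$ to $\mathcal{U}\times\mathcal{U}$ pushes down to a $2$-form $\omega_{\bar{\mathcal H}}$ on $\bar{\mathcal{H}}$, i.e. $\omega_{\bar{\mathcal H}}(T\pi\, u,T\pi\, v)=\omega_M(u,v)$ for $u,v\in\mathcal{U}(m)$. Associated (co)distributions. For a Dirac structure $D$ on a manifold $M$: $\mathsf{G}_0(m)=\{X(m)\mid (X,0)\in\Gamma(D)\}$, $\mathsf{G}_1(m)=\{X(m)\mid \exists\alpha:\ (X,\alpha)\in\Gamma(D)\}$, $\mathsf{P}_1(m)=\{\alpha(m)\mid\exists X:\ (X,\alpha)\in\Gamma(D)\}$. If $\mathsf{G}_1$ has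 constant rank, $D$ defines a skew-symmetric $2$-form on $\mathsf{G}_1$ by $(X,Y)\mapsto\alpha(Y)$ for any $\alpha$ with $(X,\alpha)\in\Gamma(D)$ and $X,Y\in\Gamma(\mathsf{G}_1)$. Reduced Dirac structure. When $D\cap\mathcal{K}^\perp$ is a vector subbundle of $TM\oplus T^*M$ (which is the case if $\mathcal{H}\cap\mathcal{V}$ has constant rank), $D_{\rm red}=\big(((D\cap\mathcal{K}^\perp)+\mathcal{K})/\mathcal{K}\big)/G$ is a Dirac structure on $\bar M$, via the identification $(\mathcal{K}^\perp/\mathcal{K})/G\simeq T\bar M\oplus T^*\bar M$; equivalently, $(\bar X,\bar\alpha)\in\Gamma(D_{\rm red})$ iff there is a vector field $X$ on $M$ that is $\pi$-related to $\bar X$ with $(X,\pi^*\bar\alpha)\in\Gamma(D)$. Its associated (co)distributions are denoted $\mathsf{G}_0^{\rm red},\mathsf{G}_1^{\rm red},\mathsf{P}_1^{\rm red}$. *)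

(* Defs.v *)
From mathcomp Require Export all_boot all_order all_algebra.
From mathcomp Require Export all_classical all_reals all_analysis.

Set Implicit Arguments.
Unset Strict Implicit.
Unset Printing Implicit Defensive.

Export Order.TTheory GRing.Theory Num.Theory.
Export numFieldNormedType.Exports.
Open Scope classical_set_scope.
Open Scope ring_scope.

(* Smooth maps between normed spaces (used with finite-dimensional V): [Ck k A f]
   is C^k-smoothness on the open set A, the derivative being controlled
   through all directional derivatives x |-> df_x(v). *)
Fixpoint Ck (R : realType) (V W : normedModType R) (k : nat)
    (A : set V) (f : V -> W) : Prop :=
  match k with
  | 0 => forall x, A x -> {for x, continuous f}
  | k'.+1 => (forall x, A x -> differentiable f x) /\
             forall v : V, Ck k' A (fun x => 'd f x v)
  end.

Definition smooth_on (R : realType) (V W : normedModType R)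
    (A : set V) (f : V -> W) : Prop := forall k, Ck k A f.

Definition smooth_near (R : realType) (V W : normedModType R)
    (f : V -> W) (x : V) : Prop :=
  exists A : set V, [/\ open A, A x & smooth_on A f].

Record chart (R : realType) (T : topologicalType) (n : nat) := Chart {
  cdom : set T;
  ccoord : T -> 'rV[R]_n;
  cinv : 'rV[R]_n -> T }.

(* [ccoord] is a homeomorphism of the open set [cdom] onto an open subset of
   R^n, with inverse [cinv]; both functions are junk elsewhere. *)
Definition is_chart (R : realType) (T : topologicalType) (n : nat)
    (c : chart R T n) : Prop :=
  [/\ open (cdom c),
      open (ccoord c @` cdom c),
      forall x, cdom c x -> cinv c (ccoord c x) = x,
      forall x, cdom c x -> {for x, continuous (ccoord c)} &
      forall z, (ccoord c @` cdom c) z -> {for z, continuous (cinv c)}].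

Definition smooth_transition (R : realType) (T : topologicalType) (n : nat)
    (c c' : chart R T n) : Prop :=
  smooth_on (ccoord c @` (cdom c `&` cdom c')) (ccoord c' \o cinv c).

(* A smooth n-manifold, given by an atlas indexed by the points: [chart_at m]
   is a chart around m.  The tangent space at m is 'rV[R]_n, a tangent vector
   being identified with its components in the chart [chart_at m]; a covector
   is likewise a column in 'cV[R]_n, a bilinear form a matrix in 'M[R]_n. *)
Record manifold (R : realType) (n : nat) := Manifold {
  mcarrier :> topologicalType;
  chart_at : mcarrier -> chart R mcarrier n;
  chart_atP : forall m, is_chart (chart_at m);
  mem_chart_at : forall m, cdom (chart_at m) m;
  chart_at_compat : forall m m', smooth_transition (chart_at m) (chart_at m');
  manifold_hausdorff : hausdorff_space mcarrier;
  manifold_countable : @second_countable mcarrier }.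

Section Manifolds.
Context {R : realType}.

Definition coord {n} {M : manifold R n} (c : M) : M -> 'rV[R]_n :=
  ccoord (chart_at c).
Definition pt {n} {M : manifold R n} (c : M) : 'rV[R]_n -> M :=
  cinv (chart_at c).

Definition compatible_chart {n} {M : manifold R n} (c : chart R M n) : Prop :=
  is_chart c /\ forall m : M, smooth_transition c (chart_at m) /\
                              smooth_transition (chart_at m) c.

Definition smooth_map_at {m n} {M : manifold R m} {N : manifold R n}
    (F : M -> N) (x : M) : Prop :=
  {for x, continuous F} /\
  smooth_near (coord (F x) \o F \o pt x) (coord x x).

Definition smooth_map_on {m n} {M : manifold R m} {N : manifold R n}
    (W : set M) (F : M -> N) : Prop := forall x, W x -> smooth_map_at F x.

Definition smooth_map2 {l m n} {L : manifold R l} {M : manifold R m}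
    {N : manifold R n} (F : L -> M -> N) : Prop :=
  forall (x : L) (y : M),
    {for (x, y), continuous (fun z : L * M => F z.1 z.2)} /\
    smooth_near (fun z : 'rV[R]_(l + m) =>
        coord (F x y) (F (pt x (lsubmx z)) (pt y (rsubmx z))))
      (row_mx (coord x x) (coord y y)).

(* The tangent map T_x F sends v to [v *m tmap F x]. *)
Definition tmap {m n} {M : manifold R m} {N : manifold R n}
    (F : M -> N) (x : M) : 'M[R]_(m, n) :=
  'J (coord (F x) \o F \o pt x) (coord x x).

(* Change of components at y, from the chart at c to the chart at c'. *)
Definition trans {n} {M : manifold R n} (c c' y : M) : 'M[R]_n :=
  'J (coord c' \o pt c) (coord c y).

(* A field (of vectors, covectors, bilinear forms) is smooth when its
   components in the charts are; since [X y] is expressed in the chart at y,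
   it has to be transported to the chart at c. *)
Definition smooth_vf {n} {M : manifold R n} (W : set M)
    (X : M -> 'rV[R]_n) : Prop :=
  forall c, W c ->
    smooth_near (fun z => let y := pt c z in X y *m trans y c y) (coord c c).

Definition smooth_1form {n} {M : manifold R n} (W : set M)
    (a : M -> 'cV[R]_n) : Prop :=
  forall c, W c ->
    smooth_near (fun z => let y := pt c z in trans c y y *m a y) (coord c c).

Definition smooth_2tensor {n} {M : manifold R n} (W : set M)
    (b : M -> 'M[R]_n) : Prop :=
  forall c, W c ->
    smooth_near (fun z => let y := pt c z in
                  trans c y y *m b y *m (trans c y y)^T) (coord c c).

Definition smooth_fun {n} {M : manifold R n} (f : M -> R) : Prop :=
  forall c, smooth_near (f \o pt c) (coord c c).

Definition ev {n} (a : 'cV[R]_n) (v : 'rV[R]_n) : R := (v *m a) 0 0.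
Definition ev2 {n} (b : 'M[R]_n) (u v : 'rV[R]_n) : R := (u *m b *m v^T) 0 0.

(* The covector w |-> b(u, w). *)
Definition contract {n} (b : 'M[R]_n) (u : 'rV[R]_n) : 'cV[R]_n := (u *m b)^T.

Definition pull1 {m n} {M : manifold R m} {N : manifold R n} (F : M -> N)
    (x : M) (a : 'cV[R]_n) : 'cV[R]_m := tmap F x *m a.
Definition pull2 {m n} {M : manifold R m} {N : manifold R n} (F : M -> N)
    (b : N -> 'M[R]_n) (x : M) : 'M[R]_m :=
  tmap F x *m b (F x) *m (tmap F x)^T.

Definition embedding {m n} {M : manifold R m} {N : manifold R n}
    (F : M -> N) : Prop :=
  [/\ smooth_map_on setT F,
      injective F,
      forall x, row_free (tmap F x) &
      forall A : set M, open A -> exists2 B : set N, open B & A = F @^-1` B].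

End Manifolds.

Section Distributions.
Context {R : realType} {n : nat}.
Implicit Type M : manifold R n.

Definition annihilator (E : set 'rV[R]_n) : set 'cV[R]_n :=
  [set a | forall v, E v -> ev a v = 0].

Definition form_orth (b : 'M[R]_n) (E : set 'rV[R]_n) : set 'rV[R]_n :=
  [set u | forall v, E v -> ev2 b u v = 0].

Definition subspace_of_rank (r : nat) (E : set 'rV[R]_n) : Prop :=
  exists A : 'M[R]_(r, n), row_free A /\ E = [set v | (v <= A)%MS].

Definition constant_rank {M} (E : M -> set 'rV[R]_n) : Prop :=
  exists r, forall m, subspace_of_rank r (E m).

Definition subbundle {M} (E : M -> set 'rV[R]_n) : Prop :=
  exists r, forall m, exists (W : set M) (X : 'I_r -> M -> 'rV[R]_n),
    [/\ open W, W m, forall j, smooth_vf W (X j) &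
        forall y, W y -> row_free (\matrix_j X j y) /\
                         E y = [set v | (v <= \matrix_j X j y)%MS]].

Definition vf_section {M} (E : M -> set 'rV[R]_n) (W : set M)
    (X : M -> 'rV[R]_n) : Prop :=
  smooth_vf W X /\ forall m, W m -> E m (X m).

Definition form_section {M} (C : M -> set 'cV[R]_n) (W : set M)
    (a : M -> 'cV[R]_n) : Prop :=
  smooth_1form W a /\ forall m, W m -> C m (a m).

(* (X, a) is a smooth section, over the open set W, of a family of subsets of
   the Pontryagin bundle TM (+) T*M. *)
Definition pont_section {M} (D : M -> set ('rV[R]_n * 'cV[R]_n)) (W : set M)
    (X : M -> 'rV[R]_n) (a : M -> 'cV[R]_n) : Prop :=
  [/\ smooth_vf W X, smooth_1form W a & forall m, W m -> D m (X m, a m)].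

Definition G0 {M} (D : M -> set ('rV[R]_n * 'cV[R]_n)) (m : M) :
    set 'rV[R]_n :=
  [set v | exists (W : set M) X,
     [/\ open W, W m, pont_section D W X (fun=> 0) & X m = v]].

Definition G1 {M} (D : M -> set ('rV[R]_n * 'cV[R]_n)) (m : M) :
    set 'rV[R]_n :=
  [set v | exists (W : set M) X a,
     [/\ open W, W m, pont_section D W X a & X m = v]].

Definition P1 {M} (D : M -> set ('rV[R]_n * 'cV[R]_n)) (m : M) :
    set 'cV[R]_n :=
  [set b | exists (W : set M) X a,
     [/\ open W, W m, pont_section D W X a & a m = b]].

Definition dirac_form_rel {M} (D : M -> set ('rV[R]_n * 'cV[R]_n)) (m : M)
    (u v : 'rV[R]_n) : set R :=
  [set r | exists (W : set M) X a,
     [/\ open W, W m, pont_section D W X a, X m = u & r = ev (a m) v]].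

(* The 2-form on G1 defined by a Dirac structure D: the value a(v) for any
   section (X, a) of D with X(m) = u. *)
Definition dirac_form {M} (D : M -> set ('rV[R]_n * 'cV[R]_n)) (m : M)
    (u v : 'rV[R]_n) : R := xget 0 (dirac_form_rel D m u v).

(* The Dirac structure associated to a distribution H and a 2-form om. *)
Definition assoc_dirac {M} (H : M -> set 'rV[R]_n) (om : M -> 'M[R]_n)
    (m : M) : set ('rV[R]_n * 'cV[R]_n) :=
  [set z | exists (W : set M) X a,
     [/\ open W, W m, vf_section H W X, smooth_1form W a &
         (forall y, W y ->
            annihilator (H y) (a y - contract (om y) (X y))) /\
         z = (X m, a m)]].

(* K = V (+) {0}, and its orthogonal TM (+) V° for the pairing of TM (+) T*M. *)
Definition vert_K (V : set 'rV[R]_n) : set ('rV[R]_n * 'cV[R]_n) :=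
  [set z | V z.1 /\ z.2 = 0].
Definition vert_Kperp (V : set 'rV[R]_n) : set ('rV[R]_n * 'cV[R]_n) :=
  [set z | annihilator V z.2].

Definition horizontal_annihilator (V H : set 'rV[R]_n) (om : 'M[R]_n) :
    set 'rV[R]_n := form_orth om (V `&` H) `&` H.

End Distributions.

Section Mechanics.
Context {R : realType} {n : nat}.

Record mechanical_system (Q : manifold R n) (k : nat) := MechanicalSystem {
  metric : Q -> 'M[R]_n;
  metric_smooth : smooth_2tensor setT metric;
  metric_sym : forall q, (metric q)^T = metric q;
  metric_pos : forall q v, v != 0 -> 0 < ev2 (metric q) v v;
  potential : Q -> R;
  potential_smooth : smooth_fun potential;
  constraint_form : 'I_k -> Q -> 'cV[R]_n;
  constraint_form_smooth : forall j, smooth_1form setT (constraint_form j);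
  constraint_form_indep :
    forall q, row_free (\matrix_j (constraint_form j q)^T) }.

Definition lagrangian {Q : manifold R n} {k} (S : mechanical_system Q k)
    (q : Q) (v : 'rV[R]_n) : R :=
  2^-1 * ev2 (metric S q) v v - potential S q.

(* The Legendre transformation in the fibre over q, as the fibre derivative of
   the Lagrangian. *)
Definition legendre {Q : manifold R n} {k} (S : mechanical_system Q k)
    (q : Q) (v : 'rV[R]_n) : 'cV[R]_n :=
  \col_j 'D_(delta_mx 0 j) (lagrangian S q) v.

Definition constraint_dist {Q : manifold R n} {k} (S : mechanical_system Q k)
    (q : Q) : set 'rV[R]_n :=
  [set v | forall j, ev (constraint_form S j q) v = 0].

(* The cotangent bundle of Q, up to its canonical isomorphisms: the points are
   in bijection with the pairs (q, covector at q), and for each chart q^i of Q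
   the canonical coordinates (q^i, p_i) form a chart of the smooth structure. *)
Definition canonical_coord {Q : manifold R n} (T : Type) (proj : T -> Q)
    (cov : T -> 'cV[R]_n) (c : Q) (p : T) : 'rV[R]_(n + n) :=
  row_mx (coord c (proj p)) (trans c (proj p) (proj p) *m cov p)^T.

Record cotangent_bundle (Q : manifold R n) := CotangentBundle {
  cotangent_manifold :> manifold R (n + n);
  cproj : cotangent_manifold -> Q;
  covector : cotangent_manifold -> 'cV[R]_n;
  cotangent_bij : bijective (fun p => (cproj p, covector p));
  cotangent_charts : forall c : Q,
    exists C : chart R cotangent_manifold (n + n),
      [/\ compatible_chart C,
          cdom C = cproj @^-1` cdom (chart_at c) &
          forall p, cdom C p ->
            ccoord C p = canonical_coord cproj covector c p] }.

(* sum_i dq^i /\ dp_i, computed at p in the canonical coordinates induced by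
   the chart of Q at the base point of p. *)
Definition omega_can {Q : manifold R n} (P : cotangent_bundle Q) (p : P) :
    'M[R]_(n + n) :=
  let J := 'J (canonical_coord (@cproj _ P) (@covector _ P) (cproj p) \o pt p)
              (coord p p) in
  J *m block_mx 0 1%:M (- 1%:M) 0 *m J^T.

Definition constraint_submanifold {Q : manifold R n} {k}
    (S : mechanical_system Q k) (P : cotangent_bundle Q) : set P :=
  [set p | exists2 v, constraint_dist S (cproj p) v &
                      covector p = legendre S (cproj p) v].

(* H = TM /\ (T pi_{T*Q})^{-1}(D), for i : M -> T*Q the inclusion. *)
Definition horizontal {Q : manifold R n} {k} (S : mechanical_system Q k)
    {P : cotangent_bundle Q} {d} {M : manifold R d} (i : M -> P) (m : M) :
    set 'rV[R]_d :=
  [set v | constraint_dist S (cproj (i m))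
             (v *m tmap i m *m tmap (@cproj _ P) (i m))].

End Mechanics.

Arguments omega_can {R n Q} P p.
Arguments constraint_submanifold {R n Q k} S P _.

Record lie_group (R : realType) (d : nat) := LieGroup {
  lie_manifold :> manifold R d;
  lmul : lie_manifold -> lie_manifold -> lie_manifold;
  lone : lie_manifold;
  linv : lie_manifold -> lie_manifold;
  lmulA : associative lmul;
  lmul1g : left_id lone lmul;
  lmulVg : left_inverse lone linv lmul;
  lmul_smooth : smooth_map2 lmul;
  linv_smooth : smooth_map_on setT linv }.

Section Symmetry.
Context {R : realType} {d : nat}.

Definition smooth_action {G : lie_group R d} {m} {M : manifold R m}
    (act : G -> M -> M) : Prop :=
  [/\ smooth_map2 act,
      forall x, act (lone G) x = x &
      forall g h x, act (lmul g h) x = act g (act h x)].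

Definition free_action {G : lie_group R d} {m} {M : manifold R m}
    (act : G -> M -> M) : Prop :=
  forall g x, act g x = x -> g = lone G.

Definition proper_action {G : lie_group R d} {m} {M : manifold R m}
    (act : G -> M -> M) : Prop :=
  forall K : set (M * M), compact K ->
    compact ((fun z : G * M => (act z.1 z.2, z.2)) @^-1` K).

(* The tangent space to the orbit through x. *)
Definition vertical {G : lie_group R d} {m} {M : manifold R m}
    (act : G -> M -> M) (x : M) : set 'rV[R]_m :=
  range (fun xi : 'rV[R]_d => xi *m tmap (act^~ x) (lone G)).

(* pi : M -> B is the quotient of M by a free and proper action: the fibres are
   the orbits, and B carries the smooth structure of the quotient manifold
   theorem, for which pi is a principal bundle.  The local trivialization
   U x G -> pi^{-1}(U) attached to a smooth local section s is
   (b, g) |-> act g (s b), with smooth inverse x |-> (pi x, gam x). *)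
Definition smooth_quotient {G : lie_group R d} {m b} {M : manifold R m}
    {B : manifold R b} (act : G -> M -> M) (pi : M -> B) : Prop :=
  [/\ smooth_map_on setT pi,
      forall y, exists x, pi x = y,
      forall x y, pi x = pi y <-> exists g, y = act g x &
      forall y, exists (U : set B) (s : B -> M) (gam : M -> G),
        [/\ open U, U y, smooth_map_on U s,
            smooth_map_on (pi @^-1` U) gam &
            (forall z, U z -> pi (s z) = z) /\
            (forall x, U (pi x) -> act (gam x) (s (pi x)) = x)]].

End Symmetry.

Section Reduction.
Context {R : realType} {m b : nat} {M : manifold R m} {B : manifold R b}.

Definition reduced_dist (pi : M -> B) (U : M -> set 'rV[R]_m) (y : B) :
    set 'rV[R]_b :=
  [set w | exists x u, [/\ pi x = y, U x u & w = u *m tmap pi x]].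

(* ((D /\ K^perp) + K) / K / G, read in TB (+) T*B: the class of an element
   (v, pi^* a) of K^perp(x) is the element (T pi v, a) over pi x. *)
Definition reduced_dirac (pi : M -> B) (V : M -> set 'rV[R]_m)
    (D : M -> set ('rV[R]_m * 'cV[R]_m)) (y : B) :
    set ('rV[R]_b * 'cV[R]_b) :=
  [set z | exists x v,
     [/\ pi x = y,
         [set s + t | s in D x `&` vert_Kperp (V x) & t in vert_K (V x)]
           (v, pull1 pi x z.2) &
         z.1 = v *m tmap pi x]].

Definition pushed_form_rel (pi : M -> B) (U : M -> set 'rV[R]_m)
    (om : M -> 'M[R]_m) (y : B) (w w' : 'rV[R]_b) : set R :=
  [set r | exists x u u',
     [/\ pi x = y, U x u /\ U x u',
         w = u *m tmap pi x, w' = u' *m tmap pi x & r = ev2 (om x) u u']].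

(* The form on T pi(U) determined by the restriction of om to U. *)
Definition pushed_form (pi : M -> B) (U : M -> set 'rV[R]_m)
    (om : M -> 'M[R]_m) (y : B) (w w' : 'rV[R]_b) : R :=
  xget 0 (pushed_form_rel pi U om y w w').

End Reduction.

(* Main.v *)
(* Write a vector v of H as the representative of a covector a when
   a = om(v, .) on H; since om is nondegenerate on the subbundle H, every
   covector has exactly one representative, smooth when the covector is, so that
   D(m) is the set of pairs (v, a) with v representing a.  If a vanishes on V then
   its representative lies in U.  Conversely, let u be in U, and let theta
   be the R^k-valued 1-form on M, pulled back from the constraint forms, with
   kernel H.  The covector om(u, .) + theta c represents u for every c, and
   it vanishes on V when c solves a linear system, which is solvable because u is
   om-orthogonal to V cap H.  The rank of the system is constant because that of
   V cap H is, so its solution of least norm is smooth.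

   Covectors vanishing on V are the pull-backs of covectors of M/G, so
   D_red is the set of pairs (T pi v, b) with v representing pi^* b.  Sections
   of D_red through a given point are obtained by extending b, representing pi^* b,
   and pushing the result forward along a local section of pi.  The G-invariance
   of H and om moves two representatives over the same point of M/G to the
   same point of M, where the skew-symmetry of om makes D_red isotropic; this
   identifies the two forms on T pi(U).

   That om is smooth requires the canonical form of the cotangent bundle not to
   depend on the chart of Q, which is the symmetry of second derivatives. *)
From HB Require Import structures.
Require Import Defs.
From mathcomp Require Import ring lra.

Set Implicit Arguments.
Unset Strict Implicit.
Unset Printing Implicit Defensive.

(** * Calculus of smooth maps *)

Section CkCalculus.
Context {R : realType}.
Implicit Types V W : normedModType R.

(** The first-order expansion of f at x is also one of g, and a continuous linear part of such an
    expansion is unique. *)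
Lemma near_eq_diff V W (f g : V -> W) (x : V) :
  (\near x, f x = g x) -> differentiable f x ->
  differentiable g x /\ 'd g x = 'd f x :> (V -> W).
Proof.
move=> fg df.
have go : g \o shift x = cst (g x) + 'd f x +o_ 0 id.
  have /eqaddoP dfo := diff_locally df.
  apply/eqaddoP => e /dfo dfe; rewrite (near_shift 0) subr0 in fg.
  near=> h.
  have fgh : f (h + x) = g (h + x) by near: h.
  have fgx : f x = g x by have := nbhs_singleton fg; rewrite /= add0r.
  have : `|(f \o shift x - (cst (f x) + 'd f x)) h| <= e * `|id h| by near: h.
  by rewrite !fctE /= fgh fgx.
have dgE : 'd g x = 'd f x :> (V -> W).
  by apply: diff_unique => //; exact: diff_continuous.
split=> //; apply/diff_locallyP; rewrite dgE; split=> //.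
exact: diff_continuous.
Unshelve. all: by end_near. Qed.

Lemma open_near_eq V W (A : set V) (f g : V -> W) x : open A -> A x ->
  (forall y, A y -> f y = g y) -> \near x, f x = g x.
Proof. by move=> oA Ax fg; apply: filterS (open_nbhs_nbhs (conj oA Ax)). Qed.

Lemma Ck_sub V W k (A B : set V) (f : V -> W) :
  A `<=` B -> Ck k B f -> Ck k A f.
Proof.
move=> AB; elim: k f => [|k IH] f /=; first by move=> fB x /AB/fB.
by case=> fB dfB; split=> [x /AB/fB//|v]; exact/IH.
Qed.

(** Openness of A turns equality on A into equality near each of its points, so the derivatives
    agree on A too and the induction goes through. *)
Lemma Ck_ext V W k (A : set V) (f g : V -> W) : open A ->
  (forall x, A x -> f x = g x) -> Ck k A f -> Ck k A g.
Proof.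
move=> oA; elim: k f g => [|k IH] f g fg /=.
  move=> fA x Ax; rewrite /prop_for /continuous_at -(fg _ Ax).
  apply: cvg_trans (fA _ Ax); apply: near_eq_cvg.
  by apply: open_near_eq Ax _.
case=> fA dfA.
have dfg x : A x -> differentiable g x /\ 'd g x = 'd f x :> (V -> W).
  by move=> Ax; apply: near_eq_diff (fA _ Ax); exact: open_near_eq Ax fg.
split=> [x /dfg[]//|v]; apply: IH (dfA v) => x Ax.
exact: (esym (congr1 (@^~ v) (dfg _ Ax).2)).
Qed.

Lemma Ck_pred V W k (A : set V) (f : V -> W) : Ck k.+1 A f -> Ck k A f.
Proof.
elim: k f => [|k IH] f.
  by case=> fA _ x /fA; exact: differentiable_continuous.
by case=> fA dfA; split=> // v; exact/IH/dfA.
Qed.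

Lemma Ck_cst V W k (A : set V) (w : W) : Ck k A (fun=> w).
Proof.
elim: k w => [|k IH] w /=; first by move=> x _; exact: cvg_cst.
split=> [x _|v]; first exact: differentiable_cst.
by under eq_fun do rewrite (diff_cst w); exact: IH.
Qed.

Lemma Ck_add V W k (A : set V) (f g : V -> W) : open A ->
  Ck k A f -> Ck k A g -> Ck k A (fun x => f x + g x).
Proof.
move=> oA; elim: k f g => [|k IH] f g /=.
  by move=> fA gA x Ax; apply: continuousD; [exact: fA|exact: gA].
case=> fA dfA [gA dgA]; split=> [x Ax|v].
  by apply: differentiableD; [exact: fA|exact: gA].
have := IH _ _ (dfA v) (dgA v); apply: Ck_ext => // x Ax /=.
exact: (esym (congr1 (@^~ v) (diffD (fA _ Ax) (gA _ Ax)))).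
Qed.

Lemma Ck_linear V W W' k (A : set V) (L : {linear W -> W'}) (f : V -> W) :
  open A -> continuous L -> Ck k A f -> Ck k A (fun x => L (f x)).
Proof.
move=> oA cL; elim: k f => [|k IH] f /=.
  move=> fA x Ax; apply: (@continuous_comp _ _ _ f L); first exact: fA.
  exact: cL.
case=> fA dfA; split=> [x Ax|v].
  apply: (@differentiable_comp _ _ _ _ f L); first exact: fA.
  exact: linear_differentiable.
have := IH _ (dfA v); apply: Ck_ext => // x Ax /=.
have dL := linear_differentiable (f x) cL.
rewrite [RHS](congr1 (@^~ v) (diff_comp (fA _ Ax) dL)) /=.
exact: (esym (congr1 (@^~ _) (diff_lin (f x) cL))).
Qed.

(** The Leibniz formula f dg + g df contains f and g undifferentiated; [Ck_pred] lowers their order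
    to that of the derivatives. *)
Lemma Ck_mul V k (A : set V) (f g : V -> R) : open A ->
  Ck k A f -> Ck k A g -> Ck k A (fun x => f x * g x).
Proof.
move=> oA; elim: k f g => [|k IH] f g.
  by move=> fA gA x Ax; apply: continuousM; [exact: fA|exact: gA].
move=> fk gk; have [fA dfA] := fk; have [gA dgA] := gk; split=> [x Ax|v].
  by apply: differentiableM; [exact: fA|exact: gA].
have := Ck_add oA (IH _ _ (Ck_pred fk) (dgA v)) (IH _ _ (Ck_pred gk) (dfA v)).
apply: Ck_ext => // x Ax /=.
exact: (esym (congr1 (@^~ v) (diffM (fA _ Ax) (gA _ Ax)))).
Qed.

(** The derivative of 1/f is - (1/f) (1/f) df, in which 1/f is one order smoother by induction than
    what has to be proved. *)
Lemma Ck_inv V k (A : set V) (f : V -> R) : open A ->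
  (forall x, A x -> f x != 0) -> Ck k A f -> Ck k A (fun x => (f x)^-1).
Proof.
move=> oA f0; elim: k f f0 => [|k IH] f f0.
  by move=> fA x Ax; apply: cvgV; [exact: f0|exact: fA].
move=> fk; have [fA dfA] := fk; split=> [x Ax|v].
  by apply: differentiableV; [exact: fA|exact: f0].
have invk := IH _ f0 (Ck_pred fk).
have := Ck_mul oA (Ck_mul oA (Ck_cst k A (-1 : R)) (Ck_mul oA invk invk)) (dfA v).
apply: Ck_ext => // x Ax /=.
rewrite [RHS](congr1 (@^~ v) (diffV (fA _ Ax) (f0 _ Ax))) /=.
by rewrite expr2 invfM mulN1r.
Qed.

Lemma Ck_sum V W k (A : set V) (I : Type) (r : seq I) (P : pred I)
    (F : I -> V -> W) : open A ->
  (forall i, P i -> Ck k A (F i)) -> Ck k A (fun x => \sum_(i <- r | P i) F i x).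
Proof.
move=> oA FA; elim: r => [|i r IH].
  by under eq_fun do rewrite big_nil; exact: Ck_cst.
case Pi: (P i); under eq_fun do rewrite big_cons Pi; last exact: IH.
apply: (Ck_add oA _ IH); exact: FA.
Qed.

Lemma Ck_prod V k (A : set V) (I : Type) (r : seq I) (P : pred I)
    (F : I -> V -> R) : open A ->
  (forall i, P i -> Ck k A (F i)) ->
  Ck k A (fun x => \prod_(i <- r | P i) F i x).
Proof.
move=> oA FA; elim: r => [|i r IH].
  by under eq_fun do rewrite big_nil; exact: Ck_cst.
case Pi: (P i); under eq_fun do rewrite big_cons Pi; last exact: IH.
apply: (Ck_mul oA _ IH); exact: FA.
Qed.

Lemma Ck_scalel V W k (A : set V) (f : V -> R) (w : W) : open A ->
  Ck k A f -> Ck k A (fun x => f x *: w).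
Proof.
move=> oA fA.
have lin : linear ( *:%R ^~ w : R -> W) by move=> u y z; rewrite scalerDl scalerA.
pose sM := GRing.isLinear.Build _ _ _ _ _ lin.
pose sL : {linear R -> W} := HB.pack ( *:%R ^~ w) sM.
by apply: (@Ck_linear V R W k A sL) => //; exact: scalel_continuous.
Qed.

Lemma Ck_coord V m n k (A : set V) (f : V -> 'M[R]_(m, n)) i j : open A ->
  Ck k A f -> Ck k A (fun x => f x i j).
Proof.
move=> oA.
have lin : linear ((fun N => N i j) : 'M[R]_(m, n) -> R).
  by move=> a M N; rewrite !mxE.
pose cM := GRing.isLinear.Build _ _ _ _ _ lin.
pose cL : {linear 'M[R]_(m, n) -> R} := HB.pack (fun N : 'M[R]_(m, n) => N i j) cM.
by apply: (@Ck_linear V _ R k A cL) => //; exact: coord_continuous.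
Qed.

(** A matrix is the sum of its entries times constant elementary matrices, so smoothness is decided
    entrywise. *)
Lemma Ck_mx V m n k (A : set V) (f : V -> 'M[R]_(m, n)) : open A ->
  (forall i j, Ck k A (fun x => f x i j)) -> Ck k A f.
Proof.
move=> oA fA; rewrite (_ : f = fun x => \sum_i \sum_j f x i j *: delta_mx i j).
  by apply: Ck_sum => // i _; apply: Ck_sum => // j _; exact/Ck_scalel/fA.
by apply/funext => x; rewrite -matrix_sum_delta.
Qed.

Lemma linear_rowE n W (L : {linear 'rV[R]_n -> W}) (v : 'rV[R]_n) :
  L v = \sum_j v 0 j *: L (delta_mx 0 j).
Proof.
by rewrite {1}[v]row_sum_delta linear_sum; apply: eq_bigr => j _; rewrite linearZ.
Qed.

(** [Ck] controls dg only in fixed directions, while the chain rule evaluates dg at f x in the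
    moving direction df_x(v). Expanding that direction in the standard basis leaves a sum of
    products, to which the induction hypothesis applies. *)
Lemma Ck_comp_real V n k (A : set V) (B : set 'rV[R]_n) (f : V -> 'rV[R]_n)
    (g : 'rV[R]_n -> R) : open A ->
  (forall x, A x -> B (f x)) -> Ck k A f -> Ck k B g -> Ck k A (g \o f).
Proof.
move=> oA AB; elim: k g => [|k IH] g.
  move=> fA gB x Ax; apply: continuous_comp; first exact: fA.
  exact/gB/AB.
move=> fk [gB dgB]; have [fA dfA] := fk; split=> [x Ax|v].
  by apply: differentiable_comp; [exact: fA|exact/gB/AB].
have fk' := Ck_pred fk.
have : Ck k A (fun x => \sum_j ('d f x v) 0 j * 'd g (f x) (delta_mx 0 j)).
  apply: Ck_sum => // j _; apply: Ck_mul => //; first exact/Ck_coord/dfA.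
  exact: (IH _ fk' (dgB (delta_mx 0 j))).
apply: Ck_ext => // x Ax.
rewrite [RHS](congr1 (@^~ v) (diff_comp (fA _ Ax) (gB _ (AB _ Ax)))) /=.
exact/esym/linear_rowE.
Qed.

Lemma Ck_comp V n p q k (A : set V) (B : set 'rV[R]_n) (f : V -> 'rV[R]_n)
    (g : 'rV[R]_n -> 'M[R]_(p, q)) : open A -> open B ->
  (forall x, A x -> B (f x)) -> Ck k A f -> Ck k B g -> Ck k A (g \o f).
Proof.
move=> oA oB AB fk gk; apply: Ck_mx => // i j.
exact: (Ck_comp_real oA AB fk (Ck_coord i j oB gk)).
Qed.

End CkCalculus.

(** * Symmetry of second derivatives *)

Section Schwarz.
Context {R : realType}.
Implicit Types V W : normedModType R.

Lemma is_derive_line V (f : V -> R) (a v : V) (s : R) :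
  differentiable f (a + s *: v) ->
  is_derive s 1 (fun t => f (a + t *: v)) ('d f (a + s *: v) v).
Proof.
move=> df.
have dl : is_diff s (fun t : R => a + t *: v) (fun t => t *: v).
  have := is_diffD (is_diff_cst a s) (is_diff_scalel s v).
  by rewrite add0r.
have [dc1 dcE] := @is_diff_comp _ _ _ _ _ _ _ _ _ dl (differentiableP df).
apply: DeriveDef; first exact: diff_derivable.
rewrite (deriveE _ dc1) dcE /=.
by rewrite scale1r.
Qed.

(** Two uses of the mean value theorem: for g on [0, h], which differentiates along v, then for t
    |-> df(v) on the segment in direction w. *)
Lemma second_difference V (A : set V) (f : V -> R) (x v w : V) (h : R) :
  0 < h -> Ck 2 A f ->
  (forall s t, 0 <= s <= h -> 0 <= t <= h -> A (x + s *: v + t *: w)) ->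
  exists s t, [/\ 0 <= s <= h, 0 <= t <= h &
    f (x + h *: v + h *: w) - f (x + h *: v) - (f (x + h *: w) - f x) =
    h ^+ 2 * 'd (fun y => 'd f y v) (x + s *: v + t *: w) w].
Proof.
move=> h0 [fA d2f] inA; have {}d2f := (d2f v).1.
have h01 : 0 <= (0 : R) <= h by apply/andP; split=> //; exact: ltW.
have hh : 0 <= h <= h by apply/andP; split=> //; exact: ltW.
pose g s := f (x + h *: w + s *: v) - f (x + s *: v).
pose dg s := 'd f (x + h *: w + s *: v) v - 'd f (x + s *: v) v.
have Dg s : 0 <= s <= h -> is_derive s 1 g (dg s).
  move=> sh; apply: is_deriveB; apply: is_derive_line; apply: fA.
    by rewrite -addrAC; exact: inA.
  by rewrite -[_ + _]addr0 -(scale0r w); exact: inA.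
have itvh s : s \in `]0, h[ -> 0 <= s <= h.
  by rewrite in_itv /= => /andP[/ltW -> /ltW ->].
have [|s /itvh sh gs] := MVT h0 (fun s sI => Dg s (itvh s sI)).
  apply: derivable_within_continuous => s; rewrite in_itv /= => sh.
  by have [] := Dg s sh.
pose k t := 'd f (x + s *: v + t *: w) v.
pose dk t := 'd (fun y => 'd f y v) (x + s *: v + t *: w) w.
have Dk t : 0 <= t <= h -> is_derive t 1 k (dk t).
  move=> th; apply: (@is_derive_line _ (fun y => 'd f y v)).
  exact/d2f/inA.
have [|t /itvh th kt] := MVT h0 (fun t tI => Dk t (itvh t tI)).
  apply: derivable_within_continuous => t; rewrite in_itv /= => th.
  by have [] := Dk t th.
exists s, t; split=> //.
have -> : f (x + h *: v + h *: w) - f (x + h *: v) - (f (x + h *: w) - f x) =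
   g h - g 0.
  by rewrite /g !scale0r !addr0 [x + h *: w + h *: v]addrAC.
rewrite gs /dg addrAC.
have -> : 'd f (x + s *: v + h *: w) v - 'd f (x + s *: v) v = k h - k 0.
  by rewrite /k scale0r addr0.
by rewrite kt /dk !subr0; ring.
Qed.

(** The second difference is symmetric in v and w. Hence the two mixed derivatives take equal values
    at two points close to x, and their continuity at x makes them differ there by at most any given
    e. *)
Lemma diff_sym V (A : set V) (f : V -> R) (x v w : V) :
  open A -> A x -> Ck 2 A f ->
  'd (fun y => 'd f y v) x w = 'd (fun y => 'd f y w) x v.
Proof.
move=> oA Ax fk; have [_ d2f] := fk.
have cvw a b : {for x, continuous (fun y => 'd (fun y => 'd f y a) y b)}.
  by have [_ /(_ b)] := d2f a; apply.
apply/eqP; rewrite -subr_eq0 -normr_le0; apply/ler_addgt0Pl => e e0.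
rewrite addr0.
have e20 : 0 < e / 2 by rewrite divr_gt0.
have : \forall y \near x, [/\ A y,
   `|'d (fun y => 'd f y v) x w - 'd (fun y => 'd f y v) y w| < e / 2 &
   `|'d (fun y => 'd f y w) x v - 'd (fun y => 'd f y w) y v| < e / 2].
  have P1 : nbhs x A by exact: open_nbhs_nbhs.
  have P2 := (cvgrPdist_lt _ _).1 (cvw v w) _ e20.
  have P3 := (cvgrPdist_lt _ _).1 (cvw w v) _ e20.
  by apply: filterS3 P1 (P2 _) (P3 _) => y *; split.
move=> /nbhs_ballP [d /= d0 dP].
(* With this h the parallelogram spanned at x by h v and h w stays within distance d / 2 of x; the
   summand 1 keeps the denominator positive when v = w = 0. *)
pose h := d / (2 * (`|v| + `|w| + 1)).
have vw0 : 0 < `|v| + `|w| + 1 by rewrite ltr_wpDl ?addr_ge0.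
have h0 : 0 < h by rewrite divr_gt0 // mulr_gt0.
have inb s t : 0 <= s <= h -> 0 <= t <= h -> ball x d (x + s *: v + t *: w).
  move=> /andP[s0 sh] /andP[t0 th].
  rewrite -ball_normE /= -addrA opprD addrA subrr sub0r normrN.
  apply: (@le_lt_trans _ _ (h * (`|v| + `|w| + 1))).
    rewrite (le_trans (ler_normD _ _)) // !normrZ !ger0_norm //.
    have sv : s * `|v| <= h * `|v| by rewrite ler_wpM2r.
    have tw : t * `|w| <= h * `|w| by rewrite ler_wpM2r.
    by rewrite !mulrDr mulr1; move: (ltW h0); lra.
  rewrite /h invfM mulrA -mulrA mulVf ?gt_eqF // mulr1.
  by rewrite ltr_pdivrMr // ltr_pMr // ltr1n.
have inb' s t : 0 <= s <= h -> 0 <= t <= h -> ball x d (x + s *: w + t *: v).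
  by move=> sh th; rewrite addrAC; exact: inb.
have [s [t [sh th E1]]] := second_difference h0 fk
  (fun s t sh th => let: And3 a _ _ := dP _ (inb s t sh th) in a).
have [s' [t' [sh' th' E2]]] := second_difference h0 fk
  (fun s t sh th => let: And3 a _ _ := dP _ (inb' s t sh th) in a).
have [_ c1 _] := dP _ (inb _ _ sh th).
have [_ _ c2] := dP _ (inb' _ _ sh' th').
(* Both mixed derivatives, times h ^ 2, equal the same second difference. *)
move: c1 c2; have : 'd (fun y => 'd f y v) (x + s *: v + t *: w) w =
   'd (fun y => 'd f y w) (x + s' *: w + t' *: v) v.
  have h2 : h ^+ 2 != 0 by rewrite expf_eq0 /= gt_eqF.
  apply: (mulfI h2); rewrite -E1 -E2 [x + h *: w + h *: v]addrAC; ring.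
move=> -> c1 c2; rewrite (splitr e) ltW //.
rewrite (le_lt_trans _ (ltrD c1 c2)) //.
by rewrite [X in _ <= _ + X]distrC
  -{1}(subrKA ('d (fun y => 'd f y w) (x + s' *: w + t' *: v) v)) ler_normD.
Unshelve. all: by end_near. Qed.

End Schwarz.

Lemma nbhs_open (T : topologicalType) (x : T) (P : set T) :
  nbhs x P -> exists A, [/\ open A, A x & A `<=` P].
Proof.
by exists P^°; split; [exact: open_interior| |exact: interior_subset].
Qed.

(** * Smoothness near a point, with the domain left implicit *)

Section SmoothNear.
Context {R : realType}.
Implicit Types V W : normedModType R.

Lemma smooth_near_ext V W (f g : V -> W) x :
  (\near x, f x = g x) -> smooth_near f x -> smooth_near g x.
Proof.
move=> fg [A [oA Ax fA]]; have := filterI (open_nbhs_nbhs (conj oA Ax)) fg.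
move=> /(_ _)/nbhs_open[B [oB Bx sB]]; exists B; split=> // k.
apply: (@Ck_ext _ _ _ k _ f) => //; first by move=> y /sB[].
by apply: Ck_sub (fA k) => y /sB[].
Qed.

(** A finite family has a common open set of smoothness, which is what allows finite sums, products
    and matrices to be treated termwise. *)
Lemma smooth_near_common (I : finType) V W (F : I -> V -> W) x :
  (forall i, smooth_near (F i) x) ->
  exists A, [/\ open A, A x & forall i, smooth_on A (F i)].
Proof.
move=> /choice [A FA].
have : \forall y \near x, forall i, A i y.
  by apply: filter_forall => i; have [oA Ax _] := FA i; exact: open_nbhs_nbhs.
move=> /nbhs_open[B [oB Bx sB]]; exists B; split=> // i k.
by have [_ _ fA] := FA i; apply: Ck_sub (fA k) => y /sB.
Qed.

Lemma smooth_near_common2 V V' W W' (f : V -> W) (g : V -> W') x :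
  smooth_near f x -> smooth_near g x ->
  exists A, [/\ open A, A x, smooth_on A f & smooth_on A g].
Proof.
move=> [A [oA Ax fA]] [B [oB Bx gB]]; exists (A `&` B); split=> //.
- exact: openI.
- by move=> k; apply: Ck_sub (fA k) => y [].
- by move=> k; apply: Ck_sub (gB k) => y [].
Qed.

Lemma smooth_near_near V W (f : V -> W) x :
  smooth_near f x -> \forall y \near x, smooth_near f y.
Proof.
move=> [A [oA Ax fA]]; apply: filterS (open_nbhs_nbhs (conj oA Ax)) => y Ay.
by exists A.
Qed.

Lemma smooth_near_diff V W (f : V -> W) x : smooth_near f x -> differentiable f x.
Proof. by move=> [A [oA Ax fA]]; exact: (fA 1%N).1. Qed.

Lemma smooth_near_cont V W (f : V -> W) x :
  smooth_near f x -> {for x, continuous f}.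
Proof. by move=> [A [oA Ax fA]]; exact: (fA 0%N). Qed.

Lemma smooth_near_cst V W (w : W) x : smooth_near (fun _ : V => w) x.
Proof. by exists setT; split=> //; [exact: openT|move=> k; exact: Ck_cst]. Qed.

Lemma smooth_near_coord V m n (f : V -> 'M[R]_(m, n)) i j x :
  smooth_near f x -> smooth_near (fun x => f x i j) x.
Proof. by move=> [A [oA Ax fA]]; exists A; split=> // k; exact: Ck_coord. Qed.

Lemma smooth_near_mx V m n (f : V -> 'M[R]_(m, n)) x :
  (forall i j, smooth_near (fun x => f x i j) x) -> smooth_near f x.
Proof.
move=> fx.
have [A [oA Ax fA]] := smooth_near_common (F := fun ij y => f y ij.1 ij.2)
  (fun ij : 'I_m * 'I_n => fx ij.1 ij.2).
by exists A; split=> // k; apply: Ck_mx => // i j; exact: (fA (i, j) k).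
Qed.

Lemma smooth_near_add V W (f g : V -> W) x :
  smooth_near f x -> smooth_near g x -> smooth_near (fun x => f x + g x) x.
Proof.
move=> fx gx; have [A [oA Ax fA gA]] := smooth_near_common2 V fx gx.
by exists A; split=> // k; exact: Ck_add.
Qed.

Lemma smooth_near_mul V (f g : V -> R) x :
  smooth_near f x -> smooth_near g x -> smooth_near (fun x => f x * g x) x.
Proof.
move=> fx gx; have [A [oA Ax fA gA]] := smooth_near_common2 V fx gx.
by exists A; split=> // k; exact: Ck_mul.
Qed.

Lemma smooth_near_sum V W (I : finType) (P : pred I) (F : I -> V -> W) x :
  (forall i, smooth_near (F i) x) -> smooth_near (fun x => \sum_(i | P i) F i x) x.
Proof.
move=> /smooth_near_common[A [oA Ax FA]].
by exists A; split=> // k; apply: Ck_sum => // i _; exact: FA.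
Qed.

Lemma smooth_near_prod V (I : finType) (P : pred I) (F : I -> V -> R) x :
  (forall i, smooth_near (F i) x) -> smooth_near (fun x => \prod_(i | P i) F i x) x.
Proof.
move=> /smooth_near_common[A [oA Ax FA]].
by exists A; split=> // k; apply: Ck_prod => // i _; exact: FA.
Qed.

Lemma smooth_near_opp V m n (f : V -> 'M[R]_(m, n)) x :
  smooth_near f x -> smooth_near (fun x => - f x) x.
Proof.
move=> fx; apply: smooth_near_mx => i j.
under eq_fun do rewrite mxE -mulN1r.
apply: smooth_near_mul; first exact: smooth_near_cst.
exact: smooth_near_coord.
Qed.

Lemma smooth_near_mulmx V m n p (f : V -> 'M[R]_(m, n)) (g : V -> 'M[R]_(n, p)) x :
  smooth_near f x -> smooth_near g x -> smooth_near (fun x => f x *m g x) x.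
Proof.
move=> fx gx; apply: smooth_near_mx => i j.
under eq_fun do rewrite mxE.
by apply: smooth_near_sum => l; apply: smooth_near_mul; exact: smooth_near_coord.
Qed.

Lemma smooth_near_tr V m n (f : V -> 'M[R]_(m, n)) x :
  smooth_near f x -> smooth_near (fun x => (f x)^T) x.
Proof.
by move=> fx; apply: smooth_near_mx => i j; under eq_fun do rewrite mxE;
  exact: smooth_near_coord.
Qed.

Lemma smooth_near_det V n (f : V -> 'M[R]_n) x :
  smooth_near f x -> smooth_near (fun x => \det (f x)) x.
Proof.
move=> fx; rewrite /determinant; apply: smooth_near_sum => s.
apply: smooth_near_mul; first exact: smooth_near_cst.
by apply: smooth_near_prod => i; exact: smooth_near_coord.
Qed.

Lemma smooth_near_inv V (f : V -> R) x :
  f x != 0 -> smooth_near f x -> smooth_near (fun x => (f x)^-1) x.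
Proof.
move=> f0 fx; have [A [oA Ax fA]] := fx.
have := filterI (open_nbhs_nbhs (conj oA Ax))
  (cvgr_neq0 _ (smooth_near_cont fx) f0).
move=> /(_ _ _)/nbhs_open[B [oB Bx sB]]; exists B; split=> // k.
apply: Ck_inv => //; first by move=> y /sB[].
by apply: Ck_sub (fA k) => y /sB[].
Qed.

Lemma near_unitmx V n (f : V -> 'M[R]_n) x :
  smooth_near f x -> f x \in unitmx -> \forall y \near x, f y \in unitmx.
Proof.
move=> fx; rewrite unitmxE unitfE => f0.
have fn0 := cvgr_neq0 _ (smooth_near_cont (smooth_near_det fx)) f0.
by apply: filterS (fn0 _) => y; rewrite unitmxE unitfE.
Qed.

(** By Cramer's rule: the determinant stays nonzero near x, and there the inverse is the adjugate
    divided by it. *)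
Lemma smooth_near_invmx V n (f : V -> 'M[R]_n) x :
  f x \in unitmx -> smooth_near f x -> smooth_near (fun x => invmx (f x)) x.
Proof.
move=> fu fx; have fnu := near_unitmx fx fu.
apply: (@smooth_near_ext _ _ (fun x => (\det (f x))^-1 *: \adj (f x))).
  by apply: filterS fnu => y fyu; rewrite /invmx fyu.
apply: smooth_near_mx => i j; under eq_fun do rewrite !mxE.
apply: smooth_near_mul.
  by apply: smooth_near_inv; [rewrite -unitfE -unitmxE|exact: smooth_near_det].
rewrite /cofactor; apply: smooth_near_mul; first exact: smooth_near_cst.
apply: smooth_near_det; apply: smooth_near_mx => k l.
by under eq_fun do rewrite !mxE; exact: smooth_near_coord.
Qed.

Lemma smooth_near_comp V n p q (f : V -> 'rV[R]_n)
    (g : 'rV[R]_n -> 'M[R]_(p, q)) x :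
  smooth_near f x -> smooth_near g (f x) -> smooth_near (g \o f) x.
Proof.
move=> [A [oA Ax fA]] [B [oB Bx gB]].
have : nbhs x (A `&` f @^-1` B).
  apply: filterI; first exact: open_nbhs_nbhs.
  by apply: (fA 0%N) => //; exact: open_nbhs_nbhs.
move=> /nbhs_open[C [oC Cx sC]]; exists C; split=> // k.
apply: (Ck_comp oC oB) (gB k); first by move=> y /sC[].
by apply: Ck_sub (fA k) => y /sC[].
Qed.

(** The rows of the Jacobian are derivatives in fixed directions, which is exactly what [Ck]
    provides one order higher. *)
Lemma smooth_near_jacobian m n (f : 'rV[R]_m -> 'rV[R]_n) x :
  smooth_near f x -> smooth_near (fun x => 'J f x) x.
Proof.
move=> [A [oA Ax fA]]; apply: smooth_near_mx => i j.
exists A; split=> // k; under eq_fun do rewrite mxE.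
by apply: Ck_coord => //; exact: (fA k.+1).2.
Qed.

Lemma smooth_near_diffv m n (f : 'rV[R]_m -> 'rV[R]_n) x v :
  smooth_near f x -> smooth_near (fun x => 'd f x v) x.
Proof.
by move=> [A [oA Ax fA]]; exists A; split=> // k; exact: (fA k.+1).2.
Qed.

End SmoothNear.

(** * Jacobian matrices, acting on row vectors from the right *)

Section Jacobian.
Context {R : realType}.

Lemma eq_mul_rV m n (A B : 'M[R]_(m, n)) :
  (forall v : 'rV_m, v *m A = v *m B) -> A = B.
Proof. by move=> AB; apply/row_matrixP => i; rewrite !rowE. Qed.

Lemma mul_jacobian m n (f : 'rV[R]_m -> 'rV[R]_n) x v : v *m 'J f x = 'd f x v.
Proof. by rewrite /jacobian mul_rV_lin1. Qed.

Lemma eq_jacobian m n (f : 'rV[R]_m -> 'rV[R]_n) x (A : 'M[R]_(m, n)) :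
  'd f x = mulmxr A :> ('rV[R]_m -> 'rV[R]_n) -> 'J f x = A.
Proof.
move=> fA; apply: eq_mul_rV => v; rewrite [LHS]mul_jacobian.
exact: (congr1 (fun h => h v) fA).
Qed.

Lemma diff_mul_jacobian m n (f : 'rV[R]_m -> 'rV[R]_n) x :
  'd f x = mulmxr ('J f x) :> ('rV[R]_m -> 'rV[R]_n).
Proof. by apply/funext => v /=; rewrite [RHS]mul_jacobian. Qed.

Lemma near_eq_jacobian m n (f g : 'rV[R]_m -> 'rV[R]_n) x :
  (\near x, f x = g x) -> differentiable f x -> 'J g x = 'J f x.
Proof.
move=> fg df; apply: eq_jacobian.
exact: (etrans (near_eq_diff fg df).2 (diff_mul_jacobian f x)).
Qed.

Lemma jacobian_comp m n p (f : 'rV[R]_m -> 'rV[R]_n) (g : 'rV[R]_n -> 'rV[R]_p) x :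
  differentiable f x -> differentiable g (f x) ->
  'J (g \o f) x = 'J f x *m 'J g (f x).
Proof.
move=> df dg; apply: eq_jacobian; apply: etrans (diff_comp df dg) _.
apply/funext => v /=; rewrite mulmxA [v *m _]mul_jacobian.
by rewrite [RHS]mul_jacobian.
Qed.

Lemma jacobian_id n (x : 'rV[R]_n) : 'J id x = 1%:M.
Proof.
apply: eq_jacobian; apply: etrans (diff_val (is_diff_def := is_diff_id x)) _.
by apply/funext => v /=; rewrite mulmx1.
Qed.

Lemma jacobian_cst m n (x : 'rV[R]_m) (w : 'rV[R]_n) : 'J (fun=> w) x = 0.
Proof.
apply: eq_jacobian; apply: etrans (diff_cst w x) _.
by apply/funext => v /=; rewrite mulmx0.
Qed.

Lemma smooth_near_id n (x : 'rV[R]_n) : smooth_near id x.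
Proof.
exists setT; split=> //; first exact: openT.
case=> [y _|k]; first exact: cvg_id.
split=> [y _|v]; first by have [] := is_diff_id y.
apply: (@Ck_ext _ _ _ k _ (fun=> v)); first exact: openT; last exact: Ck_cst.
move=> y _; apply/esym.
exact: (congr1 (@^~ v) (diff_val (is_diff_def := is_diff_id y))).
Qed.

Lemma smooth_near_mulmxr m n (A : 'M[R]_(m, n)) x :
  smooth_near (fun v : 'rV_m => v *m A) x.
Proof.
apply: smooth_near_mulmx; first exact: smooth_near_id.
exact: smooth_near_cst.
Qed.

Lemma jacobian_mulmxr m n (A : 'M[R]_(m, n)) x : 'J (fun v => v *m A) x = A.
Proof.
apply: eq_jacobian; apply: (diff_lin (f := mulmxr A)) => y.
exact/smooth_near_cont/smooth_near_mulmxr.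
Qed.

Lemma smooth_near_row_mx m n p (f : 'rV[R]_m -> 'rV[R]_n) (g : 'rV[R]_m -> 'rV[R]_p) x :
  smooth_near f x -> smooth_near g x ->
  smooth_near (fun z => row_mx (f z) (g z)) x.
Proof.
move=> fx gx; apply: smooth_near_mx => i j.
case: (split_ordP j) => l ->.
  by under eq_fun do rewrite row_mxEl; exact: smooth_near_coord.
by under eq_fun do rewrite row_mxEr; exact: smooth_near_coord.
Qed.

(** Multiplying by the constant matrices that project to the two blocks recovers f and g; the chain
    rule then reads off the two blocks of the Jacobian. *)
Lemma jacobian_row_mx m n p (f : 'rV[R]_m -> 'rV[R]_n) (g : 'rV[R]_m -> 'rV[R]_p) x :
  smooth_near f x -> smooth_near g x ->
  'J (fun z => row_mx (f z) (g z)) x = row_mx ('J f x) ('J g x).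
Proof.
move=> fx gx; have rx := smooth_near_row_mx fx gx.
have LR r (A : 'M[R]_(n + p, r)) (h : 'rV[R]_m -> 'rV[R]_r) :
    (forall z, row_mx (f z) (g z) *m A = h z) ->
    'J (fun z => row_mx (f z) (g z)) x *m A = 'J h x.
  move=> hE; rewrite -[A in LHS](jacobian_mulmxr A (row_mx (f x) (g x))).
  rewrite -(@jacobian_comp _ _ _ (fun z => row_mx (f z) (g z))).
  - by congr jacobian; apply/funext.
  - exact: smooth_near_diff.
  - exact/smooth_near_diff/smooth_near_mulmxr.
rewrite -[LHS]hsubmxK; congr row_mx.
  rewrite -(LR _ (col_mx 1%:M 0) f) => [|z].
    by rewrite -[X in X *m _]hsubmxK mul_row_col mulmx1 mulmx0 addr0.
  by rewrite mul_row_col mulmx1 mulmx0 addr0.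
rewrite -(LR _ (col_mx 0 1%:M) g) => [|z].
  by rewrite -[X in X *m _]hsubmxK mul_row_col mulmx1 mulmx0 add0r.
by rewrite mul_row_col mulmx1 mulmx0 add0r.
Qed.

End Jacobian.

Lemma smooth_near_on (R : realType) (V W : normedModType R) (A : set V)
    (f : V -> W) x : nbhs x A -> smooth_on A f -> smooth_near f x.
Proof.
move=> /nbhs_open[B [oB Bx sB]] fA; exists B; split=> // k.
exact: Ck_sub (fA k).
Qed.

(** * Smooth maps and fields on manifolds *)

Section Charts.
Context {R : realType}.

Section IsChart.
Context {T : topologicalType} {n : nat} (c : chart R T n) (cc : is_chart c).

Lemma near_cinv (x : T) (P : set T) : cdom c x ->
  nbhs x P -> \forall z \near ccoord c x, P (cinv c z).
Proof.
case: cc => _ _ cK _ cinv_cont cx Px.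
by apply: cinv_cont; [exists x|rewrite cK].
Qed.

Lemma near_cdom (x : T) : cdom c x -> \forall y \near x, cdom c y.
Proof. by case: cc => oc _ _ _ _ cx; exact: open_nbhs_nbhs. Qed.

Lemma near_ccoordK (x : T) : cdom c x ->
  \forall z \near ccoord c x, ccoord c (cinv c z) = z.
Proof.
case: cc => _ oim cK _ _ cx.
apply: filterS (open_nbhs_nbhs (conj oim _)); last by exists x.
by move=> _ [y cy <-]; rewrite cK.
Qed.

Lemma smooth_near_transition (c' : chart R T n) (x : T) :
  cdom c x -> nbhs x (cdom c') -> smooth_transition c c' ->
  smooth_near (ccoord c' \o cinv c) (ccoord c x).
Proof.
move=> cx c'x; apply: smooth_near_on.
apply: filterS3 (near_cinv cx (near_cdom cx)) (near_cinv cx c'x) (near_ccoordK cx).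
by move=> z cz c'z <-; exists (cinv c z).
Qed.

End IsChart.

Context {n : nat} {M : manifold R n}.
Implicit Types c x y : M.

Lemma cdom_self c : cdom (chart_at c) c. Proof. exact: mem_chart_at. Qed.

Lemma pt_coord c x : cdom (chart_at c) x -> pt c (coord c x) = x.
Proof. by case: (chart_atP c) => _ _ cK _ _; exact: cK. Qed.

Lemma near_pt c x (P : set M) : cdom (chart_at c) x ->
  nbhs x P -> \forall z \near coord c x, P (pt c z).
Proof. exact/near_cinv/chart_atP. Qed.

Lemma near_dom c x : cdom (chart_at c) x -> \forall y \near x, cdom (chart_at c) y.
Proof. exact/near_cdom/chart_atP. Qed.

Lemma near_coord_pt c x : cdom (chart_at c) x ->
  \forall z \near coord c x, coord c (pt c z) = z.
Proof. exact/near_ccoordK/chart_atP. Qed.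

Lemma pt_cont c x : cdom (chart_at c) x -> {for coord c x, continuous (pt c)}.
Proof.
by case: (chart_atP c) => _ _ _ _ + cx; apply; exists x.
Qed.

Lemma coord_cont c x : cdom (chart_at c) x -> {for x, continuous (coord c)}.
Proof. by case: (chart_atP c) => _ _ _ + _; apply. Qed.

Lemma near_coord c x (P : set 'rV[R]_n) : cdom (chart_at c) x ->
  nbhs (coord c x) P -> \forall y \near x, P (coord c y).
Proof. by move=> cx Px; exact: coord_cont. Qed.

Lemma smooth_near_trans c c' x : cdom (chart_at c) x -> cdom (chart_at c') x ->
  smooth_near (coord c' \o pt c) (coord c x).
Proof.
move=> cx c'x; apply: smooth_near_transition => //; first exact: chart_atP.
  exact: near_dom.
exact: chart_at_compat.
Qed.

End Charts.

Section Maps.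
Context {R : realType}.

(** The local representative of F in arbitrary charts. [smooth_map_at] and [tmap] use only the
    charts centred at x and F x, which move with x; fixed charts are needed to compare different
    points. *)
Definition rep {m n} {M : manifold R m} {N : manifold R n} (c : M) (c' : N)
  (F : M -> N) : 'rV[R]_m -> 'rV[R]_n := coord c' \o F \o pt c.

Section Comp.
Context {l m n : nat} {L : manifold R l} {M : manifold R m} {N : manifold R n}.
Variables (c : L) (c1 : M) (c2 : N).
Implicit Types (F : L -> M) (G : M -> N) (x : L).

(** Continuity of F keeps nearby values in the intermediate chart, where [pt] and [coord] cancel. *)
Lemma near_rep_comp F G x : cdom (chart_at c) x ->
  cdom (chart_at c1) (F x) -> {for x, continuous F} ->
  \forall z \near coord c x, (rep c1 c2 G \o rep c c1 F) z = rep c c2 (G \o F) z.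
Proof.
move=> cx c1x Fx; have := near_pt cx (Fx _ (near_dom c1x)).
by apply: filterS => z dz; rewrite /rep /= pt_coord.
Qed.

Lemma smooth_rep_comp F G x : cdom (chart_at c) x ->
  cdom (chart_at c1) (F x) -> {for x, continuous F} ->
  smooth_near (rep c c1 F) (coord c x) ->
  smooth_near (rep c1 c2 G) (coord c1 (F x)) ->
  smooth_near (rep c c2 (G \o F)) (coord c x).
Proof.
move=> cx c1x Fx sF sG; apply: smooth_near_ext (near_rep_comp _ cx c1x Fx) _.
by apply: smooth_near_comp => //; rewrite {2}/rep /= pt_coord.
Qed.

Lemma jacobian_rep_comp F G x : cdom (chart_at c) x ->
  cdom (chart_at c1) (F x) -> {for x, continuous F} ->
  smooth_near (rep c c1 F) (coord c x) ->
  smooth_near (rep c1 c2 G) (coord c1 (F x)) ->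
  'J (rep c c2 (G \o F)) (coord c x) =
  'J (rep c c1 F) (coord c x) *m 'J (rep c1 c2 G) (coord c1 (F x)).
Proof.
move=> cx c1x Fx sF sG.
have repx : rep c c1 F (coord c x) = coord c1 (F x) by rewrite /rep /= pt_coord.
have sGx : smooth_near (rep c1 c2 G) (rep c c1 F (coord c x)) by rewrite repx.
have dGF : differentiable (rep c1 c2 G \o rep c c1 F) (coord c x).
  by apply: smooth_near_diff; exact: smooth_near_comp.
rewrite (near_eq_jacobian (near_rep_comp G cx c1x Fx) dGF).
by rewrite (jacobian_comp (smooth_near_diff sF) (smooth_near_diff sGx)) repx.
Qed.

End Comp.

Section Trans.
Context {n : nat} {M : manifold R n}.
Implicit Types c x y : M.

Lemma smooth_rep_id c c' x : cdom (chart_at c) x -> cdom (chart_at c') x ->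
  smooth_near (rep c c' id) (coord c x).
Proof. exact: smooth_near_trans. Qed.

Lemma trans_rep c c' x : trans c c' x = 'J (rep c c' id) (coord c x).
Proof. by []. Qed.

Lemma transxx c x : cdom (chart_at c) x -> trans c c x = 1%:M.
Proof.
move=> cx; rewrite /trans -(jacobian_id (coord c x)).
apply: near_eq_jacobian; last by have [] := is_diff_id (coord c x).
by apply: filterS (near_coord_pt cx) => z /esym.
Qed.

(** The cocycle rule is the chain rule for the identity composed with itself. *)
Lemma trans_comp c c' c'' x : cdom (chart_at c) x -> cdom (chart_at c') x ->
  cdom (chart_at c'') x -> trans c c' x *m trans c' c'' x = trans c c'' x.
Proof.
move=> cx c'x c''x; rewrite !trans_rep.
rewrite -(@jacobian_rep_comp _ _ _ _ _ _ _ _ _ id id) //.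
exact: smooth_rep_id. exact: smooth_rep_id.
Qed.

Lemma transK c c' x : cdom (chart_at c) x -> cdom (chart_at c') x ->
  trans c c' x *m trans c' c x = 1%:M.
Proof. by move=> cx c'x; rewrite trans_comp // transxx. Qed.

End Trans.

Section Tmap.
Context {m n : nat} {M : manifold R m} {N : manifold R n}.
Implicit Types (F G : M -> N) (x c : M).

Lemma smooth_rep c (c' : N) F x : cdom (chart_at c) x -> cdom (chart_at c') (F x) ->
  smooth_map_at F x -> smooth_near (rep c c' F) (coord c x).
Proof.
move=> cx c'x [Fx sF].
have sFc : smooth_near (rep c (F x) F) (coord c x).
  apply: (@smooth_rep_comp _ _ _ _ _ _ c x (F x) id F) => //.
  - exact: cdom_self.
  - by apply: smooth_rep_id => //; exact: cdom_self.
apply: (@smooth_rep_comp _ _ _ _ _ _ c (F x) c' F id) => //.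
- exact: cdom_self.
- by apply: smooth_rep_id => //; exact: cdom_self.
Qed.

(** The chain rule for F composed with the identity on both sides, each identity being read as a
    change of chart. *)
Lemma jacobian_rep c (c' : N) F x : cdom (chart_at c) x -> cdom (chart_at c') (F x) ->
  smooth_map_at F x ->
  'J (rep c c' F) (coord c x) = trans c x x *m tmap F x *m trans (F x) c' (F x).
Proof.
move=> cx c'x sF; have [Fx _] := sF.
have dx := cdom_self x; have dFx := cdom_self (F x).
rewrite !trans_rep.
rewrite (@jacobian_rep_comp _ _ _ _ _ _ c (F x) c' F id) //.
- congr mulmx; rewrite (@jacobian_rep_comp _ _ _ _ _ _ c x (F x) id F) //.
    exact: smooth_rep_id.
  exact: smooth_rep.
- exact: smooth_rep.
- exact: smooth_rep_id.
Qed.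

Lemma smooth_map_rep c (c' : N) F x : cdom (chart_at c) x -> cdom (chart_at c') (F x) ->
  {for x, continuous F} -> smooth_near (rep c c' F) (coord c x) ->
  smooth_map_at F x.
Proof.
move=> cx c'x Fx sF; split=> //; have dx := cdom_self x; have dFx := cdom_self (F x).
apply: (@smooth_rep_comp _ _ _ _ _ _ x c' (F x) F id) => //; last exact: smooth_rep_id.
by apply: (@smooth_rep_comp _ _ _ _ _ _ x c c' id F) => //; exact: smooth_rep_id.
Qed.

Lemma near_eq_smooth_map F G x : (\near x, F x = G x) ->
  smooth_map_at F x -> smooth_map_at G x /\ tmap G x = tmap F x.
Proof.
move=> FG sF; have [Fx sFx] := sF; have FGx : F x = G x := nbhs_singleton FG.
have FGr : \forall z \near coord x x, rep x (F x) F z = rep x (F x) G z.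
  by apply: filterS (near_pt (cdom_self x) FG) => z; rewrite /rep /= => ->.
split.
  split; last by rewrite -FGx; exact: smooth_near_ext FGr sFx.
  by rewrite /prop_for /continuous_at -FGx; apply: cvg_trans Fx; exact: near_eq_cvg.
rewrite /tmap -FGx; exact: near_eq_jacobian FGr (smooth_near_diff sFx).
Qed.

Lemma tmap_cst (c' : N) x : tmap (fun=> c') x = 0.
Proof. exact: jacobian_cst. Qed.

End Tmap.

Section TmapComp.
Context {l m n : nat} {L : manifold R l} {M : manifold R m} {N : manifold R n}.
Implicit Types (F : L -> M) (G : M -> N).

Lemma smooth_map_comp F G x :
  smooth_map_at F x -> smooth_map_at G (F x) -> smooth_map_at (G \o F) x.
Proof.
move=> sF sG; have [Fx _] := sF; have [Gx _] := sG.
apply: (@smooth_map_rep _ _ _ _ x (G (F x))); try exact: cdom_self.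
  exact: continuous_comp.
by apply: (@smooth_rep_comp _ _ _ _ _ _ x (F x)) => //;
  try apply: smooth_rep => //; exact: cdom_self.
Qed.

Lemma tmap_comp F G x :
  smooth_map_at F x -> smooth_map_at G (F x) ->
  tmap (G \o F) x = tmap F x *m tmap G (F x).
Proof.
move=> sF sG; have [Fx _] := sF.
by apply: (@jacobian_rep_comp _ _ _ _ _ _ x (F x)) => //;
  try apply: smooth_rep => //; exact: cdom_self.
Qed.

Lemma tmap_id (x : L) : tmap id x = 1%:M.
Proof. exact/transxx/cdom_self. Qed.

Lemma smooth_map_id (x : L) : smooth_map_at id x.
Proof. by split=> //; apply: smooth_rep_id; exact: cdom_self. Qed.

End TmapComp.

End Maps.

Lemma mulmx_cancel (R : realType) m n p q (A : 'M[R]_(m, n)) (T : 'M[R]_(n, p))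
    (T' : 'M[R]_(p, n)) (B : 'M[R]_(n, q)) :
  T *m T' = 1%:M -> A *m T *m (T' *m B) = A *m B.
Proof. by move=> TK; rewrite mulmxA -(mulmxA A) TK mulmx1. Qed.

Lemma mulmx_conj_cancel (R : realType) m n p (A : 'M[R]_(m, n)) (T : 'M[R]_(n, p))
    (T' : 'M[R]_(p, n)) (b : 'M[R]_n) : T *m T' = 1%:M ->
  A *m T *m (T' *m b *m T'^T) *m (A *m T)^T = A *m b *m A^T.
Proof.
move=> TK; rewrite -(mulmxA T') mulmx_cancel // !mulmxA trmx_mul mulmxA.
by rewrite -(mulmxA (A *m b)) -trmx_mul TK trmx1 mulmx1.
Qed.

Lemma eq_smooth_near (R : realType) (V W : normedModType R) (f g : V -> W) x :
  f =1 g -> smooth_near f x -> smooth_near g x.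
Proof. by move=> /funext ->. Qed.

(** * Smooth fields of vectors, covectors and bilinear forms *)

Section Fields.
Context {R : realType} {n : nat} {M : manifold R n}.
Implicit Types (c x y : M).

(* Smoothness at c of p vector fields, given as the rows of a matrix, and of p
   covector fields, given as its columns. *)
Definition smooth_rows p c (X : M -> 'M[R]_(p, n)) :=
  smooth_near (fun z => let y := pt c z in X y *m trans y c y) (coord c c).

Definition smooth_cols p c (a : M -> 'M[R]_(n, p)) :=
  smooth_near (fun z => let y := pt c z in trans c y y *m a y) (coord c c).

Definition smooth_tensor c (b : M -> 'M[R]_n) :=
  smooth_near (fun z => let y := pt c z in
                  trans c y y *m b y *m (trans c y y)^T) (coord c c).

Definition smooth_mxfun p q c (f : M -> 'M[R]_(p, q)) :=
  smooth_near (f \o pt c) (coord c c).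

Lemma near_chart c (P : set M) : nbhs c P ->
  \forall z \near coord c c, [/\ cdom (chart_at c) (pt c z),
    coord c (pt c z) = z & P (pt c z)].
Proof.
move=> Pc; have cc := cdom_self c.
apply: filterS3 (near_pt cc (near_dom cc)) (near_coord_pt cc) (near_pt cc Pc).
by move=> z; split.
Qed.

(** Every z near [coord c c] is [coord c y] for some y in P and in the chart at c, so two local
    expressions need to be compared only at such points. *)
Lemma near_smooth_ext (V : normedModType R) c (f g : 'rV[R]_n -> V) (P : set M) :
  nbhs c P ->
  (forall y, P y -> cdom (chart_at c) y -> pt c (coord c y) = y ->
     f (coord c y) = g (coord c y)) ->
  smooth_near f (coord c c) -> smooth_near g (coord c c).
Proof.
move=> Pc fg; apply: smooth_near_ext; apply: filterS (near_chart Pc).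
by move=> z [cz zE Pz]; have := fg _ Pz cz (pt_coord cz); rewrite zE.
Qed.

Lemma smooth_rows_ext p c (X X' : M -> 'M[R]_(p, n)) :
  (\near c, X c = X' c) -> smooth_rows c X -> smooth_rows c X'.
Proof. by move=> XX'; apply: near_smooth_ext XX' _ => y /= E _ ->; rewrite E. Qed.

(** Vectors and covectors change chart by mutually inverse matrices, which cancel in the pairing. *)
Lemma smooth_rows_cols p q c (X : M -> 'M[R]_(p, n)) (a : M -> 'M[R]_(n, q)) :
  smooth_rows c X -> smooth_cols c a -> smooth_mxfun c (fun y => X y *m a y).
Proof.
move=> sX sa; apply: near_smooth_ext (filterT) _ (smooth_near_mulmx sX sa).
by move=> y _ cy /= ->; apply: mulmx_cancel; apply: transK => //; exact: cdom_self.
Qed.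

Lemma smooth_mxfun_rows p q c (f : M -> 'M[R]_(p, q)) (X : M -> 'M[R]_(q, n)) :
  smooth_mxfun c f -> smooth_rows c X -> smooth_rows c (fun y => f y *m X y).
Proof.
move=> sf sX; apply: near_smooth_ext (filterT) _ (smooth_near_mulmx sf sX).
by move=> y _ cy /= ->; rewrite mulmxA.
Qed.

Lemma smooth_cols_mxfun p q c (a : M -> 'M[R]_(n, p)) (f : M -> 'M[R]_(p, q)) :
  smooth_cols c a -> smooth_mxfun c f -> smooth_cols c (fun y => a y *m f y).
Proof.
move=> sa sf; apply: near_smooth_ext (filterT) _ (smooth_near_mulmx sa sf).
by move=> y _ cy /= ->; rewrite mulmxA.
Qed.

Lemma smooth_cols_add p c (a b : M -> 'M[R]_(n, p)) :
  smooth_cols c a -> smooth_cols c b -> smooth_cols c (fun y => a y + b y).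
Proof.
move=> sa sb; apply: near_smooth_ext (filterT) _ (smooth_near_add sa sb).
by move=> y _ cy /= ->; rewrite mulmxDr.
Qed.

Lemma smooth_contract p c (b : M -> 'M[R]_n) (X : M -> 'M[R]_(p, n)) :
  smooth_tensor c b -> smooth_rows c X ->
  smooth_cols c (fun y => (X y *m b y)^T).
Proof.
move=> sb sX.
apply: near_smooth_ext (filterT) _ (smooth_near_tr (smooth_near_mulmx sX sb)).
move=> y _ cy /= ->; have yy := cdom_self y.
have -> : X y *m trans y c y *m (trans c y y *m b y *m (trans c y y)^T) =
    X y *m (b y *m (trans c y y)^T).
  by rewrite -(mulmxA _ (b y)); apply: mulmx_cancel; exact: transK.
by rewrite mulmxA trmx_mul trmxK.
Qed.

Lemma smooth_stack p c (X : 'I_p -> M -> 'rV[R]_n) :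
  (forall j, smooth_rows c (X j)) -> smooth_rows c (fun y => \matrix_j X j y).
Proof.
move=> sX; apply: smooth_near_mx => i j.
apply: eq_smooth_near (smooth_near_coord 0 j (sX i)) => z /=.
by rewrite !mxE; apply: eq_bigr => l _; rewrite !mxE.
Qed.

Lemma smooth_cols_stack p c (a : 'I_p -> M -> 'cV[R]_n) :
  (forall j, smooth_cols c (a j)) ->
  smooth_cols c (fun y => \matrix_(i, j) a j y i 0).
Proof.
move=> sa; apply: smooth_near_mx => i j.
apply: eq_smooth_near (smooth_near_coord i 0 (sa j)) => z /=.
by rewrite !mxE; apply: eq_bigr => l _; rewrite !mxE.
Qed.

(** The covector fields with constant components b in the chart at c. They extend a covector given
    at one point, which is how sections through a prescribed element are produced. *)
Lemma smooth_cols_const p c x (b : 'M[R]_(n, p)) : cdom (chart_at c) x ->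
  smooth_cols x (fun y => trans y c y *m b).
Proof.
move=> cx; have sJ := smooth_near_jacobian (smooth_near_trans (cdom_self x) cx).
have := smooth_near_mulmx sJ (smooth_near_cst b _).
apply: near_smooth_ext (near_dom cx) _ => y cy xy /= ye; rewrite ye [RHS]mulmxA.
exact: (congr1 (mulmx^~ b) (esym (trans_comp xy (cdom_self y) cy))).
Qed.

End Fields.

Section RepComp.
Context {R : realType} {m n : nat} {M : manifold R m} {N : manifold R n}.
Implicit Types (F : M -> N) (x : M).

Lemma smooth_near_rep x F (p q : nat) (g : 'rV[R]_n -> 'M[R]_(p, q)) :
  smooth_map_at F x -> smooth_near g (coord (F x) (F x)) ->
  smooth_near (g \o rep x (F x) F) (coord x x).
Proof.
move=> sF sg; apply: smooth_near_comp; first by case: sF.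
by rewrite /rep /= pt_coord //; exact: cdom_self.
Qed.

End RepComp.

(** * Pull-back of covectors and forms, push-forward of vectors *)

Section PullPush.
Context {R : realType} {m n : nat} {M : manifold R m} {N : manifold R n}.
Implicit Types (F : M -> N) (x : M).

Section Near.
Variables (x : M) (F : M -> N).
Hypothesis sF : \forall y \near x, smooth_map_at F y.

Let sFx : smooth_map_at F x := nbhs_singleton sF.

Lemma near_smooth_dom :
  \forall y \near x, smooth_map_at F y /\ cdom (chart_at (F x)) (F y).
Proof.
have [Fx _] := sFx.
by apply: filterI sF _; exact: Fx _ (near_dom (cdom_self (F x))).
Qed.

(** Smoothness of F near x, and not only at x, lets [tmap F y] be read off one fixed local
    representative of F at all nearby y. *)
Lemma smooth_pull1 p (a : N -> 'M[R]_(n, p)) :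
  smooth_cols (F x) a -> smooth_cols x (fun y => tmap F y *m a (F y)).
Proof.
move=> sa; have [Fx sFr] := sFx.
have := smooth_near_mulmx (smooth_near_jacobian sFr) (smooth_near_rep sFx sa).
apply: near_smooth_ext near_smooth_dom _ => y [sFy dFy] xy ye /=.
have dy := cdom_self (F y).
rewrite jacobian_rep // /rep /= !ye pt_coord // [RHS]mulmxA.
by apply: mulmx_cancel; exact: transK.
Qed.

Lemma smooth_pull2 (b : N -> 'M[R]_n) :
  smooth_tensor (F x) b -> smooth_tensor x (pull2 F b).
Proof.
move=> sb; have [Fx sFr] := sFx; have sJ := smooth_near_jacobian sFr.
have := smooth_near_mulmx (smooth_near_mulmx sJ (smooth_near_rep sFx sb))
  (smooth_near_tr sJ).
apply: near_smooth_ext near_smooth_dom _ => y [sFy dFy] xy ye /=.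
have dy := cdom_self (F y).
rewrite jacobian_rep // /rep /= !ye pt_coord // /pull2.
apply: etrans (mulmx_conj_cancel _ _ (transK dy dFy)) _.
move: (trans _ _ _) (tmap _ _) (b _) => T0 J b'.
by rewrite trmx_mul !mulmxA.
Qed.

End Near.

(** X is pushed forward only from the points of a local section s of F, so the result is a field on
    N even when X is not projectable. *)
Lemma smooth_push p (s : N -> M) F y (X : M -> 'M[R]_(p, m)) :
  smooth_map_at s y -> (\forall x \near s y, smooth_map_at F x) ->
  (\near y, F (s y) = y) ->
  smooth_rows (s y) X -> smooth_rows y (fun y => X (s y) *m tmap F (s y)).
Proof.
move=> ss sF Fs sX; have [sy ssr] := ss; have Fsy : F (s y) = y := nbhs_singleton Fs.
have sFx : smooth_map_at F (s y) := nbhs_singleton sF.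
have [_ sFr] := sFx.
have near_y : \forall z \near y, [/\ smooth_map_at F (s z), F (s z) = z,
    cdom (chart_at (s y)) (s z) & cdom (chart_at y) z].
  have dsy : \forall z \near y, cdom (chart_at (s y)) (s z).
    exact: sy _ (near_dom (cdom_self (s y))).
  have sFs : \forall z \near y, smooth_map_at F (s z) by exact: sy _ sF.
  by apply: filterS3 sFs dsy (filterI Fs (near_dom (cdom_self y))) => z ? ? [].
have sXr := smooth_near_rep ss sX.
have sFr' : smooth_near (rep (s y) y F) (coord (s y) (s y)).
  by apply: smooth_rep => //; rewrite ?Fsy; exact: cdom_self.
have sJr := smooth_near_rep ss (smooth_near_jacobian sFr').
apply: near_smooth_ext near_y _ (smooth_near_mulmx sXr sJr).
move=> z [sFz Fsz dsz dz] _ ze /=; have dself := cdom_self (s z).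
rewrite /rep /= !ze pt_coord // -/(rep (s y) y F).
rewrite (@jacobian_rep _ _ _ _ _ (s y) y F (s z)) ?Fsz //.
by rewrite -[in RHS]mulmxA -(mulmxA (trans _ _ _)); apply: mulmx_cancel; exact: transK.
Qed.

End PullPush.

(** * Derivatives of dot products and of vector-valued maps *)

Section DiffDot.
Context {R : realType}.

Lemma diff_coord m p q (f : 'rV[R]_m -> 'M[R]_(p, q)) x h i j :
  smooth_near f x -> 'd (fun z => f z i j) x h = 'd f x h i j.
Proof.
move=> fx.
have lin : linear ((fun N => N i j) : 'M[R]_(p, q) -> R).
  by move=> a A B; rewrite !mxE.
pose cM := GRing.isLinear.Build _ _ _ _ _ lin.
pose cL : {linear 'M[R]_(p, q) -> R} := HB.pack (fun N : 'M[R]_(p, q) => N i j) cM.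
have cc : continuous cL by exact: coord_continuous.
have dL := linear_differentiable (f x) cc.
apply: etrans (congr1 (@^~ h) (diff_comp (smooth_near_diff fx) dL)) _.
exact: (congr1 (@^~ _) (diff_lin (f x) cc)).
Qed.

Lemma diff_sum m (I : Type) (r : seq I) (F : I -> 'rV[R]_m -> R) x h :
  (forall i, smooth_near (F i) x) ->
  'd (fun z => \sum_(i <- r) F i z) x h = \sum_(i <- r) 'd (F i) x h /\
  smooth_near (fun z => \sum_(i <- r) F i z) x.
Proof.
move=> FA; elim: r => [|i r [IH sr]].
  rewrite big_nil; split.
    under eq_fun do rewrite big_nil.
    exact: (congr1 (@^~ h) (diff_cst (0 : R) x)).
  by under eq_fun do rewrite big_nil; exact: smooth_near_cst.
rewrite big_cons; under eq_fun do rewrite big_cons.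
split; last exact: smooth_near_add.
rewrite -IH; apply: (congr1 (@^~ h) (diffD _ _)); exact: smooth_near_diff.
Qed.

Lemma diff_dot m n (f g : 'rV[R]_m -> 'rV[R]_n) x h :
  smooth_near f x -> smooth_near g x ->
  'd (fun z => (f z *m (g z)^T) 0 0) x h =
  ('d f x h *m (g x)^T) 0 0 + (f x *m ('d g x h)^T) 0 0.
Proof.
move=> fx gx; under eq_fun do rewrite mxE.
have fj j : smooth_near (fun z => f z 0 j) x by exact: smooth_near_coord.
have gj j : smooth_near (fun z => (g z)^T j 0) x.
  by apply: smooth_near_coord; exact: smooth_near_tr.
have [-> _] := diff_sum (index_enum _) h (fun j => smooth_near_mul (fj j) (gj j)).
rewrite !mxE -big_split /=; apply: eq_bigr => j _.
have dM := diffM (smooth_near_diff (fj j)) (smooth_near_diff (gj j)).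
apply: etrans (congr1 (@^~ h) dM) _ => /=.
have dgj : 'd (fun z => (g z)^T j 0) x h = ('d g x h)^T j 0.
  by under eq_fun do rewrite mxE; rewrite mxE; exact: diff_coord.
apply: (@etrans _ _ (f x 0 j * 'd (fun z => (g z)^T j 0) x h +
  (g x)^T j 0 * 'd (fun z => f z 0 j) x h)) => //.
rewrite dgj (diff_coord h 0 j fx) addrC; congr (_ + _); exact: mulrC.
Qed.

Lemma diff_sym_rV m n (f : 'rV[R]_m -> 'rV[R]_n) x u w : smooth_near f x ->
  'd (fun y => 'd f y u) x w = 'd (fun y => 'd f y w) x u.
Proof.
move=> fx; apply/rowP => j.
apply: etrans (esym (diff_coord w 0 j (smooth_near_diffv u fx))) _.
apply: etrans _ (diff_coord u 0 j (smooth_near_diffv w fx)).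
have [A [oA Ax fA]] := fx.
have f2 : Ck 2 A (fun z => f z 0 j) := Ck_coord 0 j oA (fA 2%N).
have E v : \forall y \near x, 'd (fun z => f z 0 j) y v = 'd f y v 0 j.
  by apply: filterS (smooth_near_near fx) => y fy; exact: diff_coord.
have Eu := (near_eq_diff (E u) ((f2.2 u).1 _ Ax)).2.
have Ew := (near_eq_diff (E w) ((f2.2 w).1 _ Ax)).2.
apply: etrans (congr1 (@^~ w) Eu) _.
apply: etrans _ (esym (congr1 (@^~ u) Ew)).
exact: diff_sym oA Ax f2.
Qed.

End DiffDot.

(** * The canonical symplectic form *)

Section Symplectic.
Context {R : realType}.

(** The matrix of sum_i dq^i /\ dp_i in canonical coordinates. *)
Definition standard_form n : 'M[R]_(n + n) := block_mx 0 1%:M (- 1%:M) 0.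

Lemma standard_formE m n (A B : 'M[R]_(m, n)) :
  row_mx A B *m standard_form n *m (row_mx A B)^T = A *m B^T - B *m A^T.
Proof.
rewrite /standard_form mul_row_block !mulmx0 mulmx1 mulmxN mulmx1 add0r addr0.
by rewrite tr_row_mx mul_row_col mulNmx addrC.
Qed.

Lemma eq_mx_forms m (A B : 'M[R]_m) :
  (forall u w : 'rV[R]_m, (u *m A *m w^T) 0 0 = (u *m B *m w^T) 0 0) -> A = B.
Proof.
move=> AB; apply/matrixP => i j.
have := AB (delta_mx 0 i) (delta_mx 0 j).
by rewrite -!rowE trmx_delta -!colE !mxE.
Qed.

Lemma skew_formE m n (X Y : 'M[R]_(m, n)) (u w : 'rV[R]_m) :
  (u *m (X *m Y^T - Y *m X^T) *m w^T) 0 0 =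
  (u *m X *m (w *m Y)^T) 0 0 - (w *m X *m (u *m Y)^T) 0 0.
Proof.
rewrite mulmxBr mulmxBl mxE [X in _ + X]mxE !trmx_mul !mulmxA; congr (_ - _).
transitivity ((u *m Y *m X^T *m w^T)^T 0 0); first by rewrite [RHS]mxE.
by rewrite !trmx_mul !trmxK !mulmxA.
Qed.

(* (x, xi) and (x', xi') are canonical coordinates for two charts of the base,
   phi being the transition map. *)
Section Lift.
Variables (m n : nat) (x xi x' xi' : 'rV[R]_m -> 'rV[R]_n) (phi : 'rV[R]_n -> 'rV[R]_n).
Variable z : 'rV[R]_m.
Hypotheses (sx : smooth_near x z) (sxi : smooth_near xi z).
Hypotheses (sx' : smooth_near x' z) (sxi' : smooth_near xi' z).
Hypothesis sphi : smooth_near phi (x z).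
Hypothesis x'E : \near z, phi (x z) = x' z.
Hypothesis xiE : \near z, xi z = xi' z *m ('J phi (x z))^T.

Let d2 u w := 'd (fun y => 'd phi y u) (x z) w.

Lemma lift_momentum (u : 'rV[R]_n) (k : 'rV[R]_m) :
  (u *m ('d xi z k)^T) 0 0 =
  (d2 u ('d x z k) *m (xi' z)^T) 0 0 + ('d phi (x z) u *m ('d xi' z k)^T) 0 0.
Proof.
have su : smooth_near (fun y => 'd phi y u) (x z) by exact: smooth_near_diffv.
have sux : smooth_near ((fun y => 'd phi y u) \o x) z by exact: smooth_near_comp.
have sc : smooth_near (fun _ : 'rV[R]_m => u) z by exact: smooth_near_cst.
have E1 := diff_dot k sc sxi.
have E2 := diff_dot k sux sxi'.
have E12 : \forall y \near z, (((fun y => 'd phi y u) \o x) y *m (xi' y)^T) 0 0 =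
    (u *m (xi y)^T) 0 0.
  apply: filterS xiE => y ->; rewrite trmx_mul trmxK mulmxA.
  by rewrite [u *m _]mul_jacobian.
have dux : differentiable
   (fun y => (((fun y => 'd phi y u) \o x) y *m (xi' y)^T) 0 0) z.
  apply: smooth_near_diff; apply: smooth_near_coord; apply: smooth_near_mulmx => //.
  exact: smooth_near_tr.
have E3 := congr1 (@^~ k) (near_eq_diff E12 dux).2.
have c0 : 'd (fun _ : 'rV[R]_m => u) z k = 0.
  exact: (congr1 (@^~ k) (diff_cst u z)).
have E1' : 'd (fun y => (u *m (xi y)^T) 0 0) z k = (u *m ('d xi z k)^T) 0 0.
  apply: etrans E1 _.
  apply: etrans (congr1 (fun t => (t *m (xi z)^T) 0 0 + _) c0) _.
  by rewrite mul0mx [X in X + _]mxE add0r.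
have dd := diff_comp (smooth_near_diff sx) (smooth_near_diff su).
apply: etrans (esym E1') _; apply: etrans E3 _; apply: etrans E2 _.
exact: (congr1 (fun t => (t *m (xi' z)^T) 0 0 + _) (congr1 (@^~ k) dd)).
Qed.

(** By [lift_momentum] the two forms differ only by the pairing of xi' with a second derivative of
    phi antisymmetrized in its two arguments, which vanishes. The remaining terms agree because dx'
    = dphi dx. *)
Lemma lift_symplectic :
  let J := 'J (fun y => row_mx (x y) (xi y)) z in
  let J' := 'J (fun y => row_mx (x' y) (xi' y)) z in
  J *m standard_form n *m J^T = J' *m standard_form n *m J'^T.
Proof.
pose Om (J : 'M[R]_(m, n + n)) := J *m standard_form n *m J^T.
apply: etrans (congr1 Om (jacobian_row_mx sx sxi)) _.
apply: etrans _ (esym (congr1 Om (jacobian_row_mx sx' sxi'))).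
rewrite /Om [LHS]standard_formE [RHS]standard_formE; apply: eq_mx_forms => u w.
have dx' k : 'd x' z k = 'd phi (x z) ('d x z k).
  have sphix : smooth_near (phi \o x) z by exact: smooth_near_comp.
  apply: etrans (congr1 (@^~ k) (near_eq_diff x'E (smooth_near_diff sphix)).2) _.
  exact: (congr1 (@^~ k) (diff_comp (smooth_near_diff sx) (smooth_near_diff sphi))).
have form (a b : 'rV[R]_m -> 'rV[R]_n) :
    (u *m ('J a z *m ('J b z)^T - 'J b z *m ('J a z)^T) *m w^T) 0 0 =
    ('d a z u *m ('d b z w)^T) 0 0 - ('d a z w *m ('d b z u)^T) 0 0.
  apply: etrans (skew_formE ('J a z) ('J b z) u w) _.
  have E (f : 'rV[R]_m -> 'rV[R]_n) (v : 'rV[R]_m) := mul_jacobian f z v.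
  pose dot (p q : 'rV[R]_n) := (p *m q^T) 0 0.
  exact: (congr2 (fun s t => s - t) (congr2 dot (E a u) (E b w))
    (congr2 dot (E a w) (E b u))).
apply: etrans (form x xi) _; apply: etrans _ (esym (form x' xi')).
have Lu := lift_momentum ('d x z w) u; have Lw := lift_momentum ('d x z u) w.
apply: etrans (congr2 (fun s t => s - t) Lw Lu) _.
have S : d2 ('d x z u) ('d x z w) = d2 ('d x z w) ('d x z u) by exact: diff_sym_rV.
apply: etrans (congr1 (fun s => ((s *m (xi' z)^T) 0 0 + _) - _) S) _.
rewrite opprD addrACA subrr add0r.
apply: (congr2 (fun s t => s - t)).
  exact: (congr1 (fun s => (s *m ('d xi' z w)^T) 0 0) (esym (dx' u))).
exact: (congr1 (fun s => (s *m ('d xi' z u)^T) 0 0) (esym (dx' w))).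
Qed.

End Lift.
End Symplectic.

(** * The canonical form on the cotangent bundle *)

Section Cotangent.
Context {R : realType} {n : nat} {Q : manifold R n} (P : cotangent_bundle Q).
Implicit Types (p o : P) (c : Q).

Let K c : P -> 'rV[R]_(n + n) := canonical_coord (@cproj _ _ _ P) (@covector _ _ _ P) c.

Lemma cproj_dom_open p c : cdom (chart_at c) (cproj p) ->
  \forall y \near p, cdom (chart_at c) (cproj y).
Proof.
move=> cp; have [C [[iC _] dC _]] := cotangent_charts P c.
have Cp : cdom C p by rewrite dC.
by have := near_cdom iC Cp; rewrite dC.
Qed.

Lemma smooth_canonical o p c : cdom (chart_at o) p ->
  cdom (chart_at c) (cproj p) -> smooth_near (K c \o pt o) (coord o p).
Proof.
move=> op cp; have [C [[iC Ccomp] dC CE]] := cotangent_charts P c.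
have Cp : cdom C p by rewrite dC.
have [_ oC] := Ccomp o.
have := smooth_near_transition (chart_atP o) op (near_cdom iC Cp) oC.
apply: smooth_near_ext; apply: filterS (near_pt op (near_cdom iC Cp)) => z Cz.
exact: CE.
Qed.

Lemma smooth_position o p c : cdom (chart_at o) p ->
  cdom (chart_at c) (cproj p) -> smooth_near (rep o c (@cproj _ _ _ P)) (coord o p).
Proof.
move=> op cp; have sK := smooth_canonical op cp.
apply: smooth_near_mx => i j; apply: eq_smooth_near (smooth_near_coord i (lshift n j) sK).
by move=> z; rewrite /K /canonical_coord /= row_mxEl.
Qed.

(** Near p the projection is the position half of the canonical coordinates followed by the inverse
    of a chart of Q. *)
Lemma cproj_cont p : {for p, continuous (@cproj _ _ _ P)}.
Proof.
pose c := cproj p; have cp : cdom (chart_at c) (cproj p) := cdom_self c.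
have [C [[iC _] dC CE]] := cotangent_charts P c.
have Cp : cdom C p by rewrite dC.
have [_ _ _ Ccont _] := iC.
have Kcont : {for p, continuous (fun y => lsubmx (ccoord C y) : 'rV[R]_n)}.
  apply: (@continuous_comp _ _ _ (ccoord C) (lsubmx : 'rV[R]_(n + n) -> 'rV[R]_n)).
    exact: Ccont.
  apply: smooth_near_cont; apply: smooth_near_mx => i j.
  apply: eq_smooth_near (smooth_near_coord i (lshift n j) (smooth_near_id _)) => z.
  by rewrite mxE.
have CpE y : cdom C y -> lsubmx (ccoord C y) = coord c (cproj y).
  by move=> Cy; rewrite CE // row_mxKl.
have ptcont : {for p, continuous (fun y => pt c (lsubmx (ccoord C y)))}.
  apply: (@continuous_comp _ _ _ (fun y => lsubmx (ccoord C y)) (pt c)) => //.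
  by rewrite CpE //; exact: pt_cont.
have E : \forall y \near p, pt c (lsubmx (ccoord C y)) = cproj y.
  apply: filterS (near_cdom iC Cp) => y Cy; rewrite CpE // pt_coord //.
  by rewrite dC in Cy.
rewrite /prop_for /continuous_at -(nbhs_singleton E).
by apply: cvg_trans ptcont; exact: near_eq_cvg.
Qed.

Lemma cproj_smooth p : smooth_map_at (@cproj _ _ _ P) p.
Proof.
by split; [exact: cproj_cont|apply: smooth_position; exact: cdom_self].
Qed.

Let om c o p := 'J (K c \o pt o) (coord o p) *m standard_form n *m
  ('J (K c \o pt o) (coord o p))^T.

(** [lift_symplectic] is applied with phi the transition map of Q; the momenta transform by its
    transposed Jacobian. *)
Lemma canonical_form_indep c c' o p : cdom (chart_at o) p ->
  cdom (chart_at c) (cproj p) -> cdom (chart_at c') (cproj p) ->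
  om c o p = om c' o p.
Proof.
move=> op cp c'p.
pose mom c : 'rV[R]_(n + n) -> 'rV[R]_n := fun z => let q := cproj (pt o z) in
  (trans c q q *m covector (pt o z))^T.
have smom d : cdom (chart_at d) (cproj p) -> smooth_near (mom d) (coord o p).
  move=> dp; have sK := smooth_canonical op dp.
  apply: smooth_near_mx => i j.
  apply: eq_smooth_near (smooth_near_coord i (rshift n j) sK).
  by move=> z; rewrite /K /canonical_coord /= row_mxEr.
have posE d : rep o d (@cproj _ _ _ P) (coord o p) = coord d (cproj p).
  by rewrite /rep /= pt_coord.
have both : \forall z \near coord o p, cdom (chart_at c) (cproj (pt o z)) /\
    cdom (chart_at c') (cproj (pt o z)).
  apply: filterI; first exact: near_pt op (cproj_dom_open cp).
  exact: near_pt op (cproj_dom_open c'p).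
apply: (@lift_symplectic _ _ _ (rep o c (@cproj _ _ _ P)) (mom c)
  (rep o c' (@cproj _ _ _ P)) (mom c') (coord c' \o pt c)).
- exact: smooth_position.
- exact: smom.
- exact: smooth_position.
- exact: smom.
- by rewrite posE; exact: smooth_near_trans.
- by apply: filterS both => z [cz c'z]; rewrite /rep /= pt_coord.
- apply: filterS both => z [cz c'z]; rewrite /mom /=.
  have T := trans_comp cz c'z (cdom_self _).
  apply: etrans (congr1 (fun T => (T *m covector (pt o z))^T) (esym T)) _.
  apply: etrans (congr1 trmx (esym (mulmxA _ _ _))) _.
  exact: trmx_mul.
Qed.

(** At p the form is computed in the chart of Q at the base point of p, which moves with p.
    Independence of the chart replaces it by the fixed one at the base point of o, in which the
    coordinates are smooth. *)
Lemma smooth_omega_can o : smooth_tensor o (omega_can P).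
Proof.
pose c := cproj o.
have sJ := smooth_near_jacobian (smooth_canonical (cdom_self o) (cdom_self c)).
have := smooth_near_mulmx (smooth_near_mulmx sJ (smooth_near_cst (standard_form n) _))
  (smooth_near_tr sJ).
apply: near_smooth_ext (cproj_dom_open (cdom_self c)) _ => p cp op po.
have pp := cdom_self p; have qq := cdom_self (cproj p).
apply: etrans (canonical_form_indep op cp qq) _; rewrite /= po /om.
(* [omega_can] takes the Jacobian in the chart of the bundle at p, while smoothness is tested in the
   chart at o; the chain rule supplies the transition matrix. *)
have -> : 'J (K (cproj p) \o pt o) (coord o p) =
    trans o p p *m 'J (K (cproj p) \o pt p) (coord p p).
  have sK : smooth_near (K (cproj p) \o pt p) ((coord p \o pt o) (coord o p)).
    by rewrite /= po; exact: smooth_canonical.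
  have st := smooth_near_trans op pp.
  have dc := smooth_near_diff (smooth_near_comp st sK).
  have E : \forall z \near coord o p,
      ((K (cproj p) \o pt p) \o (coord p \o pt o)) z = (K (cproj p) \o pt o) z.
    by apply: filterS (near_pt op (near_dom pp)) => z pz; rewrite /= pt_coord.
  apply: etrans (near_eq_jacobian E dc) _.
  apply: etrans (jacobian_comp (smooth_near_diff st) (smooth_near_diff sK)) _.
  by rewrite /= po.
by rewrite /omega_can -/(standard_form n) /= trmx_mul !mulmxA.
Qed.

Lemma omega_can_skew p : (omega_can P p)^T = - omega_can P p.
Proof.
rewrite /omega_can /= -/(standard_form n); move: ('J _ _) => J.
rewrite !trmx_mul trmxK mulmxA -mulNmx -mulmxN; congr (_ *m _ *m _).
by rewrite /standard_form tr_block_mx !trmx0 linearN /= trmx1 opp_block_mx oppr0 opprK.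
Qed.

End Cotangent.

(** * Actions and quotients *)

Lemma smooth_map_cst (R : realType) (k l : nat) (K : manifold R k)
    (L : manifold R l) (y : L) (a : K) : smooth_map_at (fun=> y) a.
Proof. by split; [exact: cvg_cst|exact: smooth_near_cst]. Qed.

(** * Smooth maps of two variables and their partial derivatives *)

Section TwoVariables.
Context {R : realType} {l m n : nat}.
Context {L : manifold R l} {M : manifold R m} {N : manifold R n}.
Variable F : L -> M -> N.
Hypothesis sF : smooth_map2 F.

Let F2 (x : L) (y : M) (z : 'rV[R]_(l + m)) : 'rV[R]_n :=
  coord (F x y) (F (pt x (lsubmx z)) (pt y (rsubmx z))).

Lemma smooth_map2_comp (k : nat) (K : manifold R k) (f : K -> L) (g : K -> M) a :
  smooth_map_at f a -> smooth_map_at g a ->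
  smooth_map_at (fun b => F (f b) (g b)) a /\
  tmap (fun b => F (f b) (g b)) a =
    row_mx (tmap f a) (tmap g a) *m
      'J (F2 (f a) (g a)) (row_mx (coord (f a) (f a)) (coord (g a) (g a))).
Proof.
move=> sf sg; have [fa sfr] := sf; have [ga sgr] := sg.
have [Fc sFr] := sF (f a) (g a).
pose r : 'rV[R]_k -> 'rV[R]_(l + m) :=
  fun z => row_mx (rep a (f a) f z) (rep a (g a) g z).
have sr : smooth_near r (coord a a) by exact: smooth_near_row_mx.
have ra : r (coord a a) = row_mx (coord (f a) (f a)) (coord (g a) (g a)).
  by rewrite /r /rep /= pt_coord //; exact: cdom_self.
have sFr' : smooth_near (F2 (f a) (g a)) (r (coord a a)) by rewrite ra.
have aa := cdom_self a.
have E : \forall z \near coord a a,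
    (F2 (f a) (g a) \o r) z = rep a (F (f a) (g a)) (fun b => F (f b) (g b)) z.
  have fd := near_pt aa (fa _ (near_dom (cdom_self (f a)))).
  have gd := near_pt aa (ga _ (near_dom (cdom_self (g a)))).
  apply: filterS2 fd gd => z fz gz.
  by rewrite /F2 /r /rep /= row_mxKl row_mxKr !pt_coord.
have sFr'' := smooth_near_comp sr sFr'.
split.
  split; last exact: smooth_near_ext E sFr''.
  apply: (@continuous_comp _ _ _ (fun b => (f b, g b)) (fun z => F z.1 z.2)) => //.
  exact: cvg_pair.
apply: etrans (near_eq_jacobian E (smooth_near_diff sFr'')) _.
apply: etrans (jacobian_comp (smooth_near_diff sr) (smooth_near_diff sFr')) _.
rewrite ra; apply: (congr1 (mulmx^~ _)).
exact: jacobian_row_mx.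
Qed.

Lemma smooth_map2l y x : smooth_map_at (F^~ y) x.
Proof.
by have [] := smooth_map2_comp (smooth_map_id x) (smooth_map_cst y x).
Qed.

Lemma smooth_map2r x y : smooth_map_at (F x) y.
Proof.
by have [] := smooth_map2_comp (smooth_map_cst x y) (smooth_map_id y).
Qed.

(** [smooth_map2_comp] expresses the tangent map through one common Jacobian, whose two blocks are
    identified by making f or g constant. *)
Lemma tmap2 (k : nat) (K : manifold R k) (f : K -> L) (g : K -> M) a :
  smooth_map_at f a -> smooth_map_at g a ->
  tmap (fun b => F (f b) (g b)) a =
    tmap f a *m tmap (F^~ (g a)) (f a) + tmap g a *m tmap (F (f a)) (g a).
Proof.
move=> sf sg; have [_ ->] := smooth_map2_comp sf sg.
have [_] := smooth_map2_comp (smooth_map_id (f a)) (smooth_map_cst (g a) (f a)).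
rewrite tmap_id tmap_cst => E1.
have [_] := smooth_map2_comp (smooth_map_cst (f a) (g a)) (smooth_map_id (g a)).
rewrite tmap_id tmap_cst => E2.
by rewrite E1 E2 !mulmxA -mulmxDl !mul_mx_row !mulmx1 !mulmx0 add_row_mx addr0 add0r.
Qed.

(** The derivative in the first variable consists of the first l rows of the Jacobian of one local
    representative of F, taken at the points (x, z); it therefore varies smoothly with z. For an
    action at the unit this gives smooth infinitesimal generators. *)
Lemma smooth_partial x y :
  smooth_mxfun y (fun z => tmap (F^~ z) x *m trans (F x z) (F x y) (F x z)).
Proof.
have [Fc sFr] := sF x y; have yy := cdom_self y; have xx := cdom_self x.
have sJ := smooth_near_jacobian sFr.
have sr : smooth_near (fun z : 'rV[R]_m => row_mx (coord x x) z) (coord y y).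
  by apply: smooth_near_row_mx; [exact: smooth_near_cst|exact: smooth_near_id].
have := smooth_near_mulmx (smooth_near_cst (row_mx 1%:M 0) _) (smooth_near_comp sr sJ).
have [Fy _] := smooth_map2r x y.
have nF : \forall z \near y, cdom (chart_at (F x y)) (F x z).
  exact: Fy _ (near_dom (cdom_self (F x y))).
have nS : \forall z \near y, smooth_near (F2 x y) (row_mx (coord x x) (coord y z)).
  apply: (near_coord yy (P := fun w => smooth_near (F2 x y) (row_mx (coord x x) w))).
  exact: (smooth_near_cont sr) _ (smooth_near_near sFr).
apply: near_smooth_ext (filterI nF nS) _ => z [Fz sz] yz ze; rewrite /= ze.
have sFz : smooth_map_at (F^~ z) x := smooth_map2l z x.
have E : rep x (F x y) (F^~ z) = F2 x y \o (fun w => row_mx w (coord y z)).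
  by apply/funext => w; rewrite /F2 /rep /= row_mxKl row_mxKr ze.
have sr1 : smooth_near (fun w : 'rV[R]_l => row_mx w (coord y z)) (coord x x).
  by apply: smooth_near_row_mx; [exact: smooth_near_id|exact: smooth_near_cst].
have := jacobian_rep xx Fz sFz; rewrite transxx // mul1mx => <-.
apply: esym; apply: etrans (congr1 (fun f => 'J f (coord x x)) E) _.
apply: etrans (jacobian_comp (smooth_near_diff sr1) (smooth_near_diff sz)) _.
apply: (congr1 (mulmx^~ _)).
apply: etrans (jacobian_row_mx (smooth_near_id _) (smooth_near_cst _ _)) _.
by rewrite jacobian_id jacobian_cst.
Qed.

End TwoVariables.

Section LieGroup.
Context {R : realType} {d : nat} (G : lie_group R d).

Lemma lmulgV (g : G) : lmul g (linv g) = lone G.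
Proof.
rewrite -[LHS]lmul1g -{1}(lmulVg (linv g)) -lmulA [lmul (linv g) _]lmulA.
by rewrite lmulVg lmul1g lmulVg.
Qed.

End LieGroup.

(** * Orbits, vertical spaces and local sections of the quotient *)

Section Action.
Context {R : realType} {d m b : nat} {G : lie_group R d}.
Context {M : manifold R m} {B : manifold R b}.
Variables (Psi : G -> M -> M) (pi : M -> B).
Hypothesis Psi_action : smooth_action Psi.
Hypothesis pi_quotient : smooth_quotient Psi pi.

Let sPsi : smooth_map2 Psi. Proof. by case: Psi_action. Qed.
Let Psi1 x : Psi (lone G) x = x. Proof. by case: Psi_action. Qed.
Let PsiM g h x : Psi (lmul g h) x = Psi g (Psi h x).
Proof. by case: Psi_action. Qed.
Let spi x : smooth_map_at pi x. Proof. by case: pi_quotient => + _ _ _; apply. Qed.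

Lemma act_smooth g x : smooth_map_at (Psi g) x.
Proof. exact: smooth_map2r. Qed.

Lemma quotient_act g x : pi (Psi g x) = pi x.
Proof. by case: pi_quotient => _ _ E _; apply/esym/E; exists g. Qed.

Lemma quotient_fiber x y : pi x = pi y -> exists g, y = Psi g x.
Proof. by case: pi_quotient => _ _ E _ /E. Qed.

Lemma near_quotient_smooth (x : M) : \forall y \near x, smooth_map_at pi y.
Proof. exact: filterE. Qed.

Lemma quotient_section x : exists s : B -> M,
  [/\ \forall y \near pi x, smooth_map_at s y, s (pi x) = x &
      \forall y \near pi x, pi (s y) = y].
Proof.
case: pi_quotient => _ _ _ /(_ (pi x)) [U [s [gam [oU Ux ss sgam [piK act]]]]].
have nU : \forall y \near pi x, U y by exact: open_nbhs_nbhs.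
(* The given section meets the fibre of x at s (pi x); translation by gam x moves it through x
   itself. *)
exists (Psi (gam x) \o s); split.
- apply: filterS nU => y Uy; apply: smooth_map_comp; first exact: ss.
  exact: act_smooth.
- exact: act.
- by apply: filterS nU => y Uy; rewrite /= quotient_act piK.
Qed.

(** The tangent map of a local section through x is a right inverse of T pi, by differentiating pi
    (s y) = y. *)
Lemma tmap_quotient_onto x : exists A : 'M[R]_(b, m), A *m tmap pi x = 1%:M.
Proof.
have [s [/nbhs_singleton ss sx piK]] := quotient_section x.
exists (tmap s (pi x)); have spis : smooth_map_at pi (s (pi x)) by exact: spi.
have := tmap_comp ss spis; rewrite sx => <-.
have idE : \forall y \near pi x, id y = (pi \o s) y by apply: filterS piK.
have [_ ->] := near_eq_smooth_map idE (smooth_map_id _).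
exact: tmap_id.
Qed.

(** The rows are the values at x of the fundamental vector fields of a basis of the Lie algebra, so
    that their span is the vertical space. *)
Definition generators (x : M) : 'M[R]_(d, m) := tmap (Psi^~ x) (lone G).

Lemma verticalE x : vertical Psi x = [set v | (v <= generators x)%MS].
Proof.
apply/seteqP; split=> v /=; first by move=> [xi _ <-]; exact: submxMl.
by move=> /submxP[xi ->]; exists xi.
Qed.

Lemma generators_quotient x : generators x *m tmap pi x = 0.
Proof.
have s1 : smooth_map_at (Psi^~ x) (lone G) by exact: smooth_map2l.
have spi1 : smooth_map_at pi (Psi (lone G) x) by exact: spi.
have := tmap_comp s1 spi1; rewrite Psi1 => <-.
have -> : pi \o Psi^~ x = fun=> pi x by apply/funext => g; exact: quotient_act.
exact: tmap_cst.
Qed.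

(** Since k x = (k g^-1) (g x), the orbit map of x is the one of g x after a right translation
    taking g to the unit. *)
Lemma tmap_orbit g x : (tmap (Psi^~ x) g <= generators (Psi g x))%MS.
Proof.
pose h := linv g.
have sr : smooth_map_at (fun k : G => lmul k h) g.
  exact: (smooth_map2l (@lmul_smooth _ _ G)).
have s1 : smooth_map_at (Psi^~ (Psi g x)) (lmul g h) by exact: smooth_map2l.
have := tmap_comp sr s1.
have -> : Psi^~ (Psi g x) \o (fun k : G => lmul k h) = Psi^~ x.
  by apply/funext => k /=; rewrite -PsiM -lmulA lmulVg PsiM Psi1.
by move=> ->; rewrite lmulgV submxMl.
Qed.

(** For the inclusion of the kernel, y = gam(y) s(pi y) is differentiated at x along v. If T pi v =
    0 only the contribution of gam remains, and it is tangent to the orbit. *)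
Lemma vertical_ker x : vertical Psi x = [set v | v *m tmap pi x = 0].
Proof.
rewrite verticalE; apply/seteqP; split=> v /=.
  by move=> /submxP[xi ->]; rewrite -mulmxA generators_quotient mulmx0.
move=> v0; case: pi_quotient => _ _ _ /(_ (pi x)) [U [s [gam [oU Ux ss sgam [piK act]]]]].
have nU : \forall y \near x, U (pi y).
  by have [pix _] := spi x; exact: pix _ (open_nbhs_nbhs (conj oU Ux)).
have sgx : smooth_map_at gam x by exact: sgam.
have sspi : smooth_map_at (s \o pi) x by apply: smooth_map_comp; [exact: spi|exact: ss].
have E : \forall y \near x, id y = Psi (gam y) ((s \o pi) y).
  by apply: filterS nU => y Uy; rewrite /= act.
have [_] := near_eq_smooth_map E (smooth_map_id x).
rewrite (tmap2 sPsi sgx sspi) tmap_id => T.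
have -> : v = v *m tmap gam x *m tmap (Psi^~ (s (pi x))) (gam x).
  rewrite -[LHS]mulmx1 -T mulmxDr (tmap_comp (spi x) (ss _ Ux)) !mulmxA v0.
  by rewrite !mul0mx addr0.
have := tmap_orbit (gam x) (s (pi x)); rewrite act // => sub.
exact: submx_trans (submxMl _ _) sub.
Qed.

Lemma generators_smooth x : smooth_rows x generators.
Proof.
have := smooth_partial sPsi (lone G) x.
by rewrite /smooth_mxfun /smooth_rows /comp; apply: eq_smooth_near => z;
  rewrite /= !Psi1.
Qed.

(** The row space is the kernel of T pi, and T pi is onto; so the rank does not depend on x. *)
Lemma generators_rank x : \rank (generators x) = (m - b)%N.
Proof.
have [A AT] := tmap_quotient_onto x.
have -> : \rank (generators x) = \rank (kermx (tmap pi x)).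
  apply: eqmx_rank; apply/andP; split.
    by apply/sub_kermxP; exact: generators_quotient.
  apply/rV_subP => v /sub_kermxP v0.
  have : [set v | v *m tmap pi x = 0] v by [].
  by rewrite -vertical_ker verticalE.
rewrite mxrank_ker; congr (_ - _)%N; apply/eqP.
by rewrite eqn_leq rank_leq_col /= -{1}(mxrank1 R b) -AT mxrankM_maxr.
Qed.

Lemma tmap_act_quotient g x : tmap (Psi g) x *m tmap pi (Psi g x) = tmap pi x.
Proof.
rewrite -tmap_comp; [|exact: act_smooth|exact: spi].
by have -> : pi \o Psi g = pi by apply/funext => y; exact: quotient_act.
Qed.

(** With A a right inverse of T pi, the matrix 1 - T pi A takes values in the vertical space. A
    covector a vanishing there equals T pi (A a), the pull-back of A a. *)
Lemma vert_annihilatorE x a :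
  annihilator (vertical Psi x) a <-> exists be, a = tmap pi x *m be.
Proof.
split=> [aV|[be ->] v]; last first.
  by rewrite vertical_ker /ev mulmxA => ->; rewrite mul0mx mxE.
have [A AT] := tmap_quotient_onto x; exists (A *m a).
apply/eqP; rewrite -subr_eq0; apply/eqP/row_matrixP => j; rewrite row0.
have vj : vertical Psi x (row j (1%:M - tmap pi x *m A)).
  by rewrite vertical_ker /= -row_mul mulmxBl mul1mx -mulmxA AT mulmx1 subrr row0.
have /= := aV _ vj; rewrite /ev -row_mul mulmxBl mul1mx -mulmxA => aj.
by apply/rowP => k; rewrite ord1 aj mxE.
Qed.

End Action.

(** * Dirac structures and reduction *)

Section LeastNorm.
Context {R : realType}.

Lemma row_norm_eq0 n (v : 'rV[R]_n) : v *m v^T = 0 -> v = 0.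
Proof.
move=> /matrixP/(_ 0 0); rewrite !mxE => /eqP.
rewrite psumr_eq0 => [/allP v0|j _]; last by rewrite mxE -expr2 sqr_ge0.
apply/rowP => j; have := v0 j (mem_index_enum _).
by rewrite !mxE mulf_eq0 orbb => /eqP.
Qed.

Lemma unitmx_inj n (A : 'M[R]_n) :
  (forall v : 'rV_n, v *m A = 0 -> v = 0) -> A \in unitmx.
Proof.
move=> A0; rewrite -row_free_unit -kermx_eq0; apply/eqP/row_matrixP => i.
by rewrite row0; apply: A0; rewrite -row_mul mulmx_ker row0.
Qed.

Lemma mul_row_free_eq0 m n (A : 'M[R]_(m, n)) (v : 'rV_m) :
  row_free A -> v *m A = 0 -> v = 0.
Proof. by move=> Af vA; apply: (row_free_inj Af); rewrite vA mul0mx. Qed.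

(** If v A A^T = 0 then v A has norm zero. The Gram determinant thus turns independence of rows into
    an open condition. *)
Lemma gram_unit m n (A : 'M[R]_(m, n)) : (A *m A^T \in unitmx) = row_free A.
Proof.
apply/idP/idP => [AA|Af].
  rewrite -kermx_eq0; apply/eqP/row_matrixP => i; rewrite row0.
  have : row i (kermx A) *m (A *m A^T) = 0.
    by rewrite mulmxA -row_mul mulmx_ker row0 mul0mx.
  by apply: mul_row_free_eq0; rewrite row_free_unit.
apply: unitmx_inj => v vAA; apply: (mul_row_free_eq0 Af); apply: row_norm_eq0.
by rewrite trmx_mul mulmxA -(mulmxA v) vAA mul0mx.
Qed.

(** Least norm is encoded without a minimum: the solution lies in the row space of A, the orthogonal
    complement of the solutions of A c = 0. *)
Definition least_norm_sol p q (A : 'M[R]_(p, q)) (b : 'cV[R]_p) : set 'cV[R]_q :=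
  [set c | A *m c = b /\ (c^T <= A)%MS].

Definition least_norm p q (A : 'M[R]_(p, q)) (b : 'cV[R]_p) : 'cV[R]_q :=
  xget 0 (least_norm_sol A b).

(** The difference of two solutions lies in the row space of A and is killed by A, so it is
    orthogonal to itself. *)
Lemma least_norm_unique p q (A : 'M[R]_(p, q)) b c c' :
  least_norm_sol A b c -> least_norm_sol A b c' -> c = c'.
Proof.
move=> [Ac sc] [Ac' sc']; apply/eqP; rewrite -subr_eq0; apply/eqP.
apply: trmx_inj; rewrite trmx0; apply: row_norm_eq0; rewrite trmxK.
have /submxP[y ->] : ((c - c')^T <= A)%MS by rewrite linearB /= addmx_sub ?eqmx_opp.
by rewrite -mulmxA mulmxBr Ac Ac' subrr mulmx0.
Qed.

(* Some rows of A form a basis A1 of its row space, and the least norm solution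
   is A1^T (A1 A1^T)^-1 b1. *)
Lemma least_norm_formula p q r (A : 'M[R]_(p, q)) b (f : 'I_r -> 'I_p) :
  (exists c, A *m c = b) -> \rank A = r -> row_free (rowsub f A) ->
  let A1 := rowsub f A in
  least_norm_sol A b (A1^T *m invmx (A1 *m A1^T) *m rowsub f b).
Proof.
move=> [c0 Ac0] rA fA A1; set c := _ *m rowsub f b.
have A1A : (A1 <= A)%MS by exact: rowsub_sub.
have AA1 : (A <= A1)%MS.
  by rewrite -(geq_leqif (mxrank_leqif_sup A1A)) rA (eqP fA).
have uA1 : A1 *m A1^T \in unitmx by rewrite gram_unit.
have A1c : A1 *m c = rowsub f b by rewrite /c !mulmxA mulmxV // mul1mx.
split; last first.
  rewrite /c !trmx_mul trmxK mulmxA; exact: submx_trans (submxMl _ _) A1A.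
have /submxP[N AN] := AA1.
by rewrite {1}AN -mulmxA A1c -Ac0 -mul_rowsub_mx mulmxA -/A1 -AN.
Qed.

Lemma least_normP p q (A : 'M[R]_(p, q)) b :
  (exists c, A *m c = b) -> least_norm_sol A b (least_norm A b).
Proof.
move=> sol; apply: xgetPex; eexists.
apply: (@least_norm_formula _ _ (\rank A) A b (maxrankfun A) sol) => //.
exact: maxrowsub_free.
Qed.

Lemma smooth_near_rowsub (V : normedModType R) p q r (f : 'I_r -> 'I_p)
    (A : V -> 'M[R]_(p, q)) x :
  smooth_near A x -> smooth_near (fun z => rowsub f (A z)) x.
Proof.
move=> sA; apply: smooth_near_mx => i j.
by apply: eq_smooth_near (smooth_near_coord (f i) j sA) => z; rewrite mxE.
Qed.

(** Rows forming a basis at z stay independent nearby, and by constancy of the rank they still span.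
    The same choice f therefore gives the explicit smooth formula near z, and uniqueness identifies
    it with [least_norm]. *)
Lemma smooth_least_norm m p q r (A : 'rV[R]_m -> 'M[R]_(p, q))
    (b : 'rV[R]_m -> 'cV[R]_p) z :
  smooth_near A z -> smooth_near b z -> (forall y, \rank (A y) = r) ->
  (\forall y \near z, exists c, A y *m c = b y) ->
  smooth_near (fun y => least_norm (A y) (b y)) z.
Proof.
move=> sA sb rA sol.
have [f fA] : exists f : 'I_r -> 'I_p, row_free (rowsub f (A z)).
  by rewrite -(rA z); exists (maxrankfun (A z)); exact: maxrowsub_free.
have sA1 := smooth_near_rowsub f sA; have sb1 := smooth_near_rowsub f sb.
have sG := smooth_near_mulmx sA1 (smooth_near_tr sA1).
have uG : rowsub f (A z) *m (rowsub f (A z))^T \in unitmx by rewrite gram_unit.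
have form : \forall y \near z, least_norm_sol (A y) (b y)
   ((rowsub f (A y))^T *m invmx (rowsub f (A y) *m (rowsub f (A y))^T) *m rowsub f (b y)).
  apply: filterS2 sol (near_unitmx sG uG) => y soly; rewrite gram_unit => fAy.
  exact: least_norm_formula.
pose gram y := rowsub f (A y) *m (rowsub f (A y))^T.
have sI := @smooth_near_invmx _ _ _ gram z uG sG.
have := smooth_near_mulmx (smooth_near_mulmx (smooth_near_tr sA1) sI) sb1.
apply: smooth_near_ext; apply: filterS2 form sol => y fy soly.
exact: least_norm_unique fy (least_normP soly).
Qed.

(** The Fredholm alternative, with the cokernel of A^T providing the relations l among the rows of
    A. *)
Lemma solvable_mulmx p q (A : 'M[R]_(p, q)) (b : 'cV[R]_p) :
  (forall l : 'rV_p, l *m A = 0 -> l *m b = 0) -> exists c, A *m c = b.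
Proof.
move=> sol; have : (b^T <= A^T)%MS.
  rewrite submxE -[X in X == _]trmxK trmx_mul trmxK.
  suff -> : (cokermx A^T)^T *m b = 0 by rewrite trmx0.
  apply/row_matrixP => i; rewrite row_mul row0; apply: sol.
  by rewrite -row_mul -[X in row i (X)]trmxK trmx_mul trmxK mulmx_coker trmx0 row0.
move=> /submxP[c bc]; exists c^T; apply: trmx_inj.
by rewrite trmx_mul trmxK bc.
Qed.

End LeastNorm.

Section Covectors.
Context {R : realType} {n : nat}.
Implicit Types (a : 'cV[R]_n) (u v : 'rV[R]_n) (b : 'M[R]_n).

Lemma evB a a' v : ev (a - a') v = ev a v - ev a' v.
Proof. by rewrite /ev mulmxBr !mxE. Qed.

Lemma ev_contract b u v : ev (contract b u) v = ev2 b u v.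
Proof.
rewrite /ev /contract /ev2; transitivity ((v *m (u *m b)^T)^T 0 0).
  by rewrite [RHS]mxE.
by rewrite trmx_mul trmxK.
Qed.

Lemma contractB b u v : contract b (u - v) = contract b u - contract b v.
Proof. by rewrite /contract mulmxBl linearB. Qed.

Lemma ev2Bl b u u' v : ev2 b (u - u') v = ev2 b u v - ev2 b u' v.
Proof. by rewrite -!ev_contract contractB evB. Qed.

Lemma ev2C b u v : b^T = - b -> ev2 b u v = - ev2 b v u.
Proof.
move=> bT; rewrite /ev2; transitivity ((u *m b *m v^T)^T 0 0).
  by rewrite [RHS]mxE.
by rewrite !trmx_mul trmxK bT mulNmx mulmxN mxE mulmxA.
Qed.

Lemma ev_mulmx p (T : 'M[R]_(p, n)) a (v : 'rV[R]_p) : ev a (v *m T) = ev (T *m a) v.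
Proof. by rewrite /ev mulmxA. Qed.

Lemma ev2_mulmx p (T : 'M[R]_(p, n)) b (v w : 'rV[R]_p) :
  ev2 b (v *m T) (w *m T) = ev2 (T *m b *m T^T) v w.
Proof. by rewrite /ev2 trmx_mul !mulmxA. Qed.

Lemma ev_eq0 a : (forall v, ev a v = 0) -> a = 0.
Proof.
move=> a0; apply/colP => j; have := a0 (delta_mx 0 j).
by rewrite /ev -rowE !mxE.
Qed.

Lemma annihilator_rows p (A : 'M[R]_(p, n)) a :
  annihilator [set v | (v <= A)%MS] a <-> A *m a = 0.
Proof.
split=> [aA|Aa v /= /submxP[x ->]]; last by rewrite /ev -mulmxA Aa mulmx0 mxE.
apply/row_matrixP => j; rewrite row0; apply/rowP => k; rewrite ord1 [RHS]mxE row_mul.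
exact: aA (row j A) (row_sub j A).
Qed.

End Covectors.

(** * Representatives of covectors in H and the Dirac structure D *)

Section Sharp.
Context {R : realType} {n : nat} {M : manifold R n}.
Variables (H : M -> set 'rV[R]_n) (om : M -> 'M[R]_n).
Hypothesis H_subbundle : subbundle H.
Hypothesis H_nondegenerate : forall m u, H m u ->
  (forall v, H m v -> ev2 (om m) u v = 0) -> u = 0.
Hypothesis om_smooth : forall m, smooth_tensor m om.
Hypothesis om_skew : forall m, (om m)^T = - om m.

Lemma distributionB m u v : H m u -> H m v -> H m (u - v).
Proof.
have [r /(_ m)[W [X [oW Wm sX HX]]]] := H_subbundle.
by have [_ ->] := HX m Wm; move=> /= uH vH; rewrite addmx_sub ?eqmx_opp.
Qed.

Definition sharp_rel m (a : 'cV[R]_n) : set 'rV[R]_n :=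
  [set v | H m v /\ annihilator (H m) (a - contract (om m) v)].

Definition sharp m (a : 'cV[R]_n) : 'rV[R]_n := xget 0 (sharp_rel m a).

Lemma sharp_relP m a v : sharp_rel m a v <->
  H m v /\ forall w, H m w -> ev a w = ev2 (om m) v w.
Proof.
split=> -[Hv av]; split=> // w Hw.
  by have := av w Hw; rewrite evB ev_contract => /eqP; rewrite subr_eq0 => /eqP.
by rewrite evB ev_contract av // subrr.
Qed.

(** The difference of two representatives lies in H and is orthogonal to H. *)
Lemma sharp_rel_unique m a v v' : sharp_rel m a v -> sharp_rel m a v' -> v = v'.
Proof.
move=> /sharp_relP[Hv av] /sharp_relP[Hv' av']; apply/eqP; rewrite -subr_eq0.
apply/eqP; apply: (@H_nondegenerate m); first exact: distributionB.
by move=> w Hw; rewrite ev2Bl -av // -av' // subrr.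
Qed.

(* In a local frame F of H the equation reads
   F a = (F om^T F^T) x^T for the vector x F. *)
Lemma sharp_local m : exists (r : nat) (F : M -> 'M[R]_(r, n)),
  let Gm y := F y *m (F y *m om y)^T in
  [/\ smooth_rows m F, Gm m \in unitmx &
     \forall y \near m,
       forall a, sharp_rel y a ((invmx (Gm y) *m (F y *m a))^T *m F y)].
Proof.
have [r /(_ m)[W [X [oW Wm sX HX]]]] := H_subbundle.
exists r, (fun y => \matrix_j X j y); pose F y := \matrix_j X j y.
rewrite -/F; move=> Gm; have uG y : W y -> Gm y \in unitmx.
  move=> Wy; have [Ff HF] := HX y Wy; rewrite -/(F y) in Ff HF.
  apply: unitmx_inj => x xG; apply: (mul_row_free_eq0 Ff).
  apply: (@H_nondegenerate y); first by rewrite HF /= submxMl.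
  move=> w; rewrite HF /= => /submxP[z ->].
  (* Transposing the form in [Gm] only changes a sign, by skew-symmetry, so x in the left kernel
     makes x F orthogonal to all of H. *)
  have xG' : x *m F y *m om y *m (F y)^T = 0.
    apply: oppr_inj; rewrite oppr0 -xG /Gm -/(F y) trmx_mul om_skew.
    by rewrite mulNmx !mulmxN !mulmxA.
  by rewrite /ev2 trmx_mul mulmxA xG' mul0mx mxE.
split; [|exact: uG|].
  by apply: smooth_stack => j; exact: sX.
apply: filterS (open_nbhs_nbhs (conj oW Wm)) => y Wy a.
have [Ff HF] := HX y Wy; rewrite -/(F y) in Ff HF; rewrite /sharp_rel /= HF.
split; first by rewrite /= submxMl.
apply/annihilator_rows; rewrite /contract mulmxBr -(mulmxA _ (F y)) trmx_mul trmxK.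
rewrite (mulmxA (F y)) -/(Gm y) mulmxA mulmxV ?mul1mx ?subrr //.
exact: uG.
Qed.

Lemma sharpP m a : sharp_rel m a (sharp m a).
Proof.
have [r [F [_ _ /nbhs_singleton sF]]] := sharp_local m.
by apply: xgetPex; eexists; exact: sF.
Qed.

Lemma sharpE m a v : sharp_rel m a v -> sharp m a = v.
Proof. by move=> av; exact: sharp_rel_unique (sharpP m a) av. Qed.

(** In a local frame the representative is obtained by inverting a smooth matrix; uniqueness
    identifies this formula with [sharp]. *)
Lemma sharp_smooth m (a : M -> 'cV[R]_n) :
  smooth_cols m a -> smooth_rows m (fun y => sharp y (a y)).
Proof.
move=> sa; have [r [F [sF uG relF]]] := sharp_local m.
pose Gm y := F y *m (F y *m om y)^T.
have sG : smooth_mxfun m Gm := smooth_rows_cols sF (smooth_contract (om_smooth m) sF).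
have sI : smooth_mxfun m (fun y => invmx (Gm y)).
  apply: (@smooth_near_invmx _ _ _ (Gm \o pt m)) => //.
  by rewrite /= pt_coord //; exact: cdom_self.
have sx : smooth_mxfun m (fun y => (invmx (Gm y) *m (F y *m a y))^T).
  exact: smooth_near_tr (smooth_near_mulmx sI (smooth_rows_cols sF sa)).
have := smooth_mxfun_rows sx sF.
apply: smooth_rows_ext; apply: filterS relF => y sy.
by apply/esym/sharpE; exact: sy.
Qed.

(** D is defined by local sections. To put a single pair into it, the covector is extended with
    constant components in a chart and the extension is represented in H. *)
Lemma assoc_diracE m z : assoc_dirac H om m z <-> sharp_rel m z.2 z.1.
Proof.
split=> [[W [X [a [oW Wm [sX HX] sa [aX ->]]]]]|zm].
  by split; [exact: HX|exact: aX].
exists (cdom (chart_at m)), (fun y => sharp y (trans y m y *m z.2)),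
  (fun y => trans y m y *m z.2); have mm := cdom_self m.
have sa y : cdom (chart_at m) y -> smooth_cols y (fun y => trans y m y *m z.2).
  by move=> my; exact: smooth_cols_const.
split=> //.
- by case: (chart_atP m).
- split=> y my; first exact: sharp_smooth (sa y my).
  by have [] := sharpP y (trans y m y *m z.2).
- split=> [y my|]; first by have [] := sharpP y (trans y m y *m z.2).
  rewrite transxx // mul1mx (sharpE zm); exact: surjective_pairing.
Qed.

Lemma distribution0 m : H m 0.
Proof.
by have [Hv _] := sharpP m 0; rewrite -(subrr (sharp m 0)); exact: distributionB.
Qed.

Lemma sharp_rel00 m : sharp_rel m 0 0.
Proof.
apply/sharp_relP; split; first exact: distribution0.
by move=> w _; rewrite /ev /ev2 mulmx0 !mul0mx.
Qed.

Lemma assoc_dirac_G0 m : G0 (assoc_dirac H om) m = [set 0].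
Proof.
apply/seteqP; split=> v /=.
  move=> [W [X [oW Wm [_ _ DX] <-]]]; have /assoc_diracE /= Xm := DX m Wm.
  exact: sharp_rel_unique Xm (sharp_rel00 m).
move=> ->; exists setT, (fun=> 0); split=> //; first exact: openT.
split=> [y _|y _|y _].
- apply: eq_smooth_near (smooth_near_cst (0 : 'rV[R]_n) _) => z.
  by rewrite /= mul0mx.
- apply: eq_smooth_near (smooth_near_cst (0 : 'cV[R]_n) _) => z.
  by rewrite /= mulmx0.
- by apply/assoc_diracE; exact: sharp_rel00.
Qed.

Lemma sharp_section W (a : M -> 'cV[R]_n) : smooth_1form W a ->
  pont_section (assoc_dirac H om) W (fun y => sharp y (a y)) a.
Proof.
move=> sa; split=> // [y Wy|y Wy]; first exact: sharp_smooth (sa y Wy).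
by apply/assoc_diracE; exact: sharpP.
Qed.

Lemma assoc_dirac_P1 m : P1 (assoc_dirac H om) m = setT.
Proof.
apply/seteqP; split=> // b _.
have mm := cdom_self m; pose a y := trans y m y *m b.
exists (cdom (chart_at m)), (fun y => sharp y (a y)), a; split=> //.
- by case: (chart_atP m).
- by apply: sharp_section => y my; exact: smooth_cols_const.
- by rewrite /a transxx // mul1mx.
Qed.

End Sharp.

(** * The horizontal annihilator and the reduced Dirac structure *)

Section Reduction.
Context {R : realType} {dM dG dB k : nat}.
Context {M : manifold R dM} {G : lie_group R dG} {B : manifold R dB}.
Variables (H : M -> set 'rV[R]_dM) (om : M -> 'M[R]_dM).
Hypothesis H_subbundle : subbundle H.
Hypothesis H_nondegenerate : forall m u, H m u ->
  (forall v, H m v -> ev2 (om m) u v = 0) -> u = 0.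
Hypothesis om_smooth : forall m, smooth_tensor m om.
Hypothesis om_skew : forall m, (om m)^T = - om m.
Variable theta : M -> 'M[R]_(dM, k).
Hypothesis theta_smooth : forall m, smooth_cols m theta.
Hypothesis H_theta : forall m, H m = [set v | v *m theta m = 0].
Variables (Psi : G -> M -> M) (pi : M -> B).
Hypothesis Psi_action : smooth_action Psi.
Hypothesis pi_quotient : smooth_quotient Psi pi.
Hypothesis H_invariant : forall g m v, H m v -> H (Psi g m) (v *m tmap (Psi g) m).
Hypothesis om_invariant : forall g m, pull2 (Psi g) om m = om m.
Let V := vertical Psi.
Hypothesis HV_rank : constant_rank (fun m => H m `&` V m).
Let D := assoc_dirac H om.
Let DK := fun m => D m `&` vert_Kperp (V m).
Let U := fun m => horizontal_annihilator (V m) (H m) (om m).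
Let Hbar := reduced_dist pi U.
Let Dred := reduced_dirac pi V D.
Let sharp := sharp H om.
Let sharp_rel := sharp_rel H om.

Let DE m z : D m z <-> sharp_rel m z.2 z.1.
Proof. exact: assoc_diracE. Qed.

Let sharp_sharp m a : sharp_rel m a (sharp m a).
Proof. exact: sharpP. Qed.

Let sharp_eq m a v : sharp_rel m a v -> sharp m a = v.
Proof. exact: sharpE. Qed.

Lemma horizontal_annihilator_of m a v :
  sharp_rel m a v -> annihilator (V m) a -> U m v.
Proof.
move=> /sharp_relP[Hv av] aV; split=> // w [Vw Hw].
by rewrite -av // aV.
Qed.

(** The values of theta on the generators: the matrix of the linear system for the correction term
    c. *)
Let Theta m := generators Psi m *m theta m.

(** Rank-nullity for theta on the vertical space: its kernel there is V cap H, and both dimensions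
    are constant. *)
Lemma Theta_rank : exists r, forall m, \rank (Theta m) = r.
Proof.
have [r HVr] := HV_rank; exists (dM - dB - r)%N => m.
have [Z [Zf HVZ]] := HVr m.
rewrite -(generators_rank Psi_action pi_quotient m) -(mxrank_mul_ker _ (theta m)).
rewrite -/(Theta m); have -> : \rank (generators Psi m :&: kermx (theta m))%MS = r.
  rewrite -(eqP Zf); apply: eqmx_rank; apply/andP.
  have Zin (v : 'rV[R]_dM) : (v <= Z)%MS = (v <= generators Psi m :&: kermx (theta m))%MS.
    apply/idP/idP => [vZ|].
      have : [set v | (v <= Z)%MS] v by []; rewrite -HVZ H_theta /V verticalE.
      by move=> [vt vG]; rewrite sub_capmx; apply/andP; split=> //; exact/sub_kermxP.
    rewrite sub_capmx => /andP[vG /sub_kermxP vt].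
    have : (H m `&` V m) v by rewrite H_theta /V verticalE.
    by rewrite HVZ.
  by split; apply/rV_subP => v; rewrite Zin.
by rewrite addnK.
Qed.

(* As theta vanishes on H, the second term does not affect the restriction to H;
   it makes the covector vanish on V, and the least norm solution is smooth. *)
Definition vert_correction m (u : 'rV[R]_dM) : 'cV[R]_dM :=
  contract (om m) u +
  theta m *m least_norm (Theta m) (- (generators Psi m *m contract (om m) u)).

(** A relation l among the rows of [Theta] is a combination of generators lying in V cap H, on which
    om(u, .) vanishes. *)
Lemma vert_correction_solvable m u : U m u ->
  exists c, Theta m *m c = - (generators Psi m *m contract (om m) u).
Proof.
move=> [Uu _]; apply: solvable_mulmx => l lT; rewrite mulmxN.
apply/eqP; rewrite oppr_eq0; apply/eqP; apply/rowP => j; rewrite ord1 mulmxA.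
rewrite [RHS]mxE -[LHS]/(ev (contract (om m) u) (l *m generators Psi m)).
rewrite ev_contract; apply: Uu; split; first by rewrite /V verticalE /= submxMl.
by rewrite H_theta /= -mulmxA.
Qed.

Lemma vert_correctionP m u : U m u ->
  annihilator (V m) (vert_correction m u) /\ sharp_rel m (vert_correction m u) u.
Proof.
move=> Uu; have [Tc _] := least_normP (vert_correction_solvable Uu).
split.
  rewrite /V verticalE; apply/annihilator_rows.
  by rewrite /vert_correction mulmxDr mulmxA -/(Theta m) Tc subrr.
split; first by case: Uu.
move=> w; rewrite H_theta /= => wt.
by rewrite /vert_correction addrAC subrr add0r /ev mulmxA wt mul0mx mxE.
Qed.

Lemma vert_correction_smooth (W : set M) X : open W -> vf_section U W X ->
  smooth_1form W (fun m => vert_correction m (X m)).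
Proof.
move=> oW [sX UX] c Wc; have [r Tr] := Theta_rank.
have sc : smooth_cols c (fun m => contract (om m) (X m)).
  exact: smooth_contract (om_smooth c) (sX c Wc).
have sG := generators_smooth Psi_action c.
have sT : smooth_mxfun c Theta := smooth_rows_cols sG (theta_smooth c).
have sb : smooth_mxfun c (fun m => - (generators Psi m *m contract (om m) (X m))).
  exact: smooth_near_opp (smooth_rows_cols sG sc).
suff sL : smooth_mxfun c (fun m => least_norm (Theta m)
    (- (generators Psi m *m contract (om m) (X m)))).
  exact: (smooth_cols_add sc (smooth_cols_mxfun (theta_smooth c) sL)).
apply: (@smooth_least_norm _ _ _ _ _ (Theta \o pt c) _ _ sT sb) => [y|].
  exact: Tr.
apply: (near_pt (cdom_self c) (P := fun y => exists e,
  Theta y *m e = - (generators Psi y *m contract (om y) (X y)))).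
apply: filterS (open_nbhs_nbhs (conj oW Wc)) => y Wy.
exact: vert_correction_solvable (UX y Wy).
Qed.

Lemma section_horizontal_annihilator (W : set M) X : open W -> smooth_vf W X ->
  (vf_section U W X <->
   exists2 a, form_section (fun m => annihilator (V m)) W a &
              pont_section DK W X a).
Proof.
move=> oW sX; split=> [UX|[a [_ aV] [_ _ DKX]]]; last first.
  split=> // m Wm; have [/DE Dm _] := DKX m Wm.
  exact: horizontal_annihilator_of Dm (aV m Wm).
have [_ UX'] := UX; have sa := vert_correction_smooth oW UX.
exists (fun m => vert_correction m (X m)).
  by split=> // m /UX' /vert_correctionP[].
by split=> // m /UX' /vert_correctionP[aV rel]; split=> //; exact/DE.
Qed.

(** Such a covector is prescribed on H by v and is zero on V, and the two span the tangent space. *)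
Lemma horizontal_form_unique m v a a' :
  [set v + h | v in V m & h in H m] = setT ->
  annihilator (V m) a -> annihilator (V m) a' ->
  sharp_rel m a v -> sharp_rel m a' v -> a = a'.
Proof.
move=> VH aV aV' /sharp_relP[_ av] /sharp_relP[_ av'].
apply/eqP; rewrite -subr_eq0; apply/eqP/ev_eq0 => w.
have : [set v + h | v in V m & h in H m] w by rewrite VH.
move=> [w1 Vw [h Hh <-]].
have evDr c (x y : 'rV[R]_dM) : ev c (x + y) = ev c x + ev c y.
  by rewrite /ev mulmxDl mxE.
by rewrite evB !evDr aV // aV' // av // av' // subrr.
Qed.

Lemma sharp_vert_section (W : set M) a :
  form_section (fun m => annihilator (V m)) W a ->
  vf_section U W (fun m => sharp m (a m)) /\
  pont_section D W (fun m => sharp m (a m)) a.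
Proof.
move=> [sa aV]; have [sX _ DX] :=
  sharp_section H_subbundle H_nondegenerate om_smooth om_skew sa.
split=> //; split=> // m Wm.
exact: horizontal_annihilator_of (sharp_sharp m (a m)) (aV m Wm).
Qed.

Lemma proj_DK m : [set z.2 | z in DK m] = annihilator (V m).
Proof.
apply/seteqP; split=> [_ [z [_ zV] <-]//|a aV].
by exists (sharp m a, a) => //; split=> //; apply/DE; exact: sharp_sharp.
Qed.

(** An element of K changes the vector only by a vertical one, which T pi kills, and leaves the
    covector alone. *)
Lemma reduced_diracE y z : Dred y z <->
  exists x v, [/\ pi x = y, sharp_rel x (tmap pi x *m z.2) v & z.1 = v *m tmap pi x].
Proof.
have V0 x v : V x v -> v *m tmap pi x = 0.
  by rewrite /V (vertical_ker Psi_action pi_quotient).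
split=> [[x [v [xy [s [/DE Ds _] [t [Vt t0] stE]] zv]]]|[x [v [xy rel zv]]]].
  have sv : s.1 = v - t.1 by rewrite -[v]/((v, pull1 pi x z.2).1) -stE addrK.
  have sz : s.2 = tmap pi x *m z.2.
    by rewrite -[RHS]/((v, pull1 pi x z.2).2) -stE /= t0 addr0.
  exists x, s.1; split; rewrite -?sz //.
  by rewrite sv mulmxBl (V0 _ _ Vt) subr0.
exists x, v; split=> //; exists (v, pull1 pi x z.2).
  split; first exact/DE.
  by apply/(vert_annihilatorE Psi_action pi_quotient); exists z.2.
exists (0, 0); last by rewrite addr0.
split=> //; rewrite /V (vertical_ker Psi_action pi_quotient) /=.
exact: mul0mx.
Qed.

(* The representative of the pull-back of a covector field extending be is pushed
   forward along a local section of pi through x. *)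
Lemma reduced_section x (be : 'cV[R]_dB) : exists (W : set B) X a,
  [/\ open W, W (pi x), pont_section Dred W X a,
      X (pi x) = sharp x (tmap pi x *m be) *m tmap pi x & a (pi x) = be].
Proof.
have [s [ss sx piK]] := quotient_section Psi_action pi_quotient x.
have yy := cdom_self (pi x); have spi := near_quotient_smooth pi_quotient.
have [W [oW Wx sW]] := nbhs_open (filterI (filterI ss piK) (near_dom yy)).
pose a (y : B) := trans y (pi x) y *m be.
pose X z := sharp z (tmap pi z *m a (pi z)).
have ax : a (pi x) = be by rewrite /a (transxx yy) mul1mx.
have sa y : W y -> smooth_cols y a.
  by move=> /sW[_ dy]; exact: smooth_cols_const.
exists W, (fun y => X (s y) *m tmap pi (s y)), a; split; [exact: oW|exact: Wx| | |].
- split=> [y Wy|y Wy|y Wy]; [|exact: sa|].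
    have [[ssy _] _] := sW y Wy.
    have Wn : \forall z \near y, W z by exact: open_nbhs_nbhs.
    have piKy : \forall z \near y, pi (s z) = z.
      by apply: filterS Wn => z /sW[[]].
    have piy := nbhs_singleton piKy.
    apply: (smooth_push ssy (spi _) piKy).
    apply: (sharp_smooth H_subbundle H_nondegenerate om_smooth om_skew).
    have sa' : smooth_cols (pi (s y)) a by rewrite piy; exact: sa.
    exact: (smooth_pull1 (spi (s y)) sa').
  have [[_ piy] _] := sW y Wy; apply/reduced_diracE.
  exists (s y), (X (s y)); split; [exact: piy| |exact: erefl].
  (* X (s y) represents the pull-back of a (pi (s y)), whereas that of a (y) is asked for; the claim
     is transported along pi (s y) = y. *)
  exact: (eq_ind (pi (s y))
    (fun t => sharp_rel (s y) (tmap pi (s y) *m a t) (X (s y)))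
    (sharp_sharp _ _) y piy).
- by rewrite sx /X ax.
- exact: ax.
Qed.

Lemma quotient_onto y : exists x, pi x = y.
Proof. by case: pi_quotient => _ + _ _; apply. Qed.

Lemma horizontal_of_pullback x be v : sharp_rel x (tmap pi x *m be) v -> U x v.
Proof.
move=> /horizontal_annihilator_of; apply.
by apply/(vert_annihilatorE Psi_action pi_quotient); exists be.
Qed.

(** [vert_correction] gives a covector that u represents and that vanishes on V, hence a pull-back
    from the quotient. *)
Lemma reduced_horizontal x u : U x u -> exists be, sharp_rel x (tmap pi x *m be) u.
Proof.
move=> /vert_correctionP[aV rel].
have [be aE] := (vert_annihilatorE Psi_action pi_quotient _ _).1 aV.
by exists be; rewrite -aE.
Qed.

Lemma reduced_G1 y : G1 Dred y = Hbar y.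
Proof.
apply/seteqP; split=> w.
  move=> [W [X [a [oW Wy [_ _ DX] <-]]]].
  have /reduced_diracE[x [v [xy rel /= ->]]] := DX y Wy.
  exists x, v; split=> //.
  exact: horizontal_of_pullback rel.
move=> [x [u [<- Uu ->]]]; have [be rel] := reduced_horizontal Uu.
have [W [X [a [oW Wx sec Xx _]]]] := reduced_section x be.
exists W, X, a; split=> //; rewrite Xx.
by rewrite (sharp_eq rel).
Qed.

Lemma reduced_G0 y : G0 Dred y = [set 0].
Proof.
apply/seteqP; split=> w /=.
  move=> [W [X [oW Wy [_ _ DX] <-]]].
  have /reduced_diracE[x [v [_ rel /= ->]]] := DX y Wy.
  rewrite mulmx0 in rel.
  have r0 := sharp_rel00 H_subbundle H_nondegenerate om_skew x.
  by rewrite (sharp_rel_unique H_subbundle H_nondegenerate rel r0) mul0mx.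
move=> ->; exists setT, (fun=> 0); split=> //; first exact: openT.
split=> [c _|c _|c _].
- apply: eq_smooth_near (smooth_near_cst (0 : 'rV[R]_dB) _) => z.
  by rewrite /= mul0mx.
- apply: eq_smooth_near (smooth_near_cst (0 : 'cV[R]_dB) _) => z.
  by rewrite /= mulmx0.
- apply/reduced_diracE; have [x xc] := quotient_onto c.
  exists x, 0; split=> //=; last by rewrite mul0mx.
  by rewrite mulmx0; exact: sharp_rel00.
Qed.

Lemma reduced_P1 y : P1 Dred y = setT.
Proof.
apply/seteqP; split=> // be _; have [x <-] := quotient_onto y.
have [W [X [a [oW Wx sec _ ax]]]] := reduced_section x be.
by exists W, X, a.
Qed.

(** Every vector of H at g x is the translate of one of H at x, and neither om nor a pull-back along
    pi changes under translation. *)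
Lemma sharp_rel_act g x be v : sharp_rel x (tmap pi x *m be) v ->
  sharp_rel (Psi g x) (tmap pi (Psi g x) *m be) (v *m tmap (Psi g) x).
Proof.
move=> /sharp_relP[Hv av]; apply/sharp_relP; split; first exact: H_invariant.
move=> w' Hw'; pose h := linv g.
have [_ Psi1 PsiM] := Psi_action.
have hg : Psi h (Psi g x) = x by rewrite -PsiM lmulVg Psi1.
pose w := w' *m tmap (Psi h) (Psi g x).
have Hw : H x w by rewrite -hg; exact: H_invariant.
have w'E : w' = w *m tmap (Psi g) x.
  have sh := act_smooth Psi_action h (Psi g x).
  have sg := act_smooth Psi_action g (Psi h (Psi g x)).
  have := tmap_comp sh sg; rewrite hg.
  have -> : Psi g \o Psi h = id.
    by apply/funext => z; rewrite /= -PsiM lmulgV Psi1.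
  by rewrite tmap_id /w -mulmxA => <-; rewrite mulmx1.
rewrite w'E ev2_mulmx ev_mulmx mulmxA tmap_act_quotient //.
by rewrite -[X in ev2 X]/(pull2 (Psi g) om x) om_invariant; exact: av.
Qed.

(** Once the first representative is translated to the point of the second, both pairings are values
    of om on the same two vectors, in opposite order. *)
Lemma reduced_isotropic y z1 z2 :
  Dred y z1 -> Dred y z2 -> ev z1.2 z2.1 = - ev z2.2 z1.1.
Proof.
move=> /reduced_diracE[x1 [v1 [<- rel1 ->]]] /reduced_diracE[x2 [v2 [x21 rel2 ->]]].
have [g x2E] := quotient_fiber pi_quotient (esym x21).
move: rel2 x21; rewrite x2E => rel2 x21.
have [Hv1 av1] := (sharp_relP _ _ _ _ _).1 (sharp_rel_act g rel1).
have [Hv2 av2] := (sharp_relP _ _ _ _ _).1 rel2.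
rewrite ev_mulmx av1 // (ev2C _ _ (om_skew _)) -av2 // !ev_mulmx; congr (- _).
by rewrite mulmxA tmap_act_quotient.
Qed.

Lemma reduced_dirac_section y w be : Dred y (w, be) -> exists (W : set B) X a,
  [/\ open W, W y, pont_section Dred W X a, X y = w & a y = be].
Proof.
move=> /reduced_diracE[x [v [<- rel /= ->]]].
have [W [X [a [oW Wx sec Xx ax]]]] := reduced_section x be.
exists W, X, a; split=> //; rewrite Xx.
by rewrite (sharp_eq rel).
Qed.

Lemma reduced_HbarP y w : Hbar y w <-> exists be, Dred y (w, be).
Proof.
rewrite -reduced_G1; split=> [[W [X [a [oW Wy [_ _ DX] <-]]]]|[be]].
  by exists (a y); exact: DX.
by move=> /reduced_dirac_section[W [X [a [oW Wy sec Xy _]]]]; exists W, X, a.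
Qed.

(** Choosing be2 with (w', be2) in [Dred], isotropy turns either side into - be2(w), which involves
    neither be nor be'. *)
Lemma reduced_value_unique y w be be' w' : Dred y (w, be) -> Dred y (w, be') ->
  Hbar y w' -> ev be w' = ev be' w'.
Proof.
move=> D1 D2 /reduced_HbarP[be2 D3].
by rewrite (reduced_isotropic D1 D3) (reduced_isotropic D2 D3).
Qed.

Lemma dirac_form_relE y u be v r : Dred y (u, be) -> Hbar y v ->
  dirac_form_rel Dred y u v r <-> r = ev be v.
Proof.
move=> Du Hv; split=> [[W [X [a [oW Wy [_ _ DX] Xy ->]]]]|->].
  by apply: reduced_value_unique Du Hv; rewrite -Xy; exact: DX.
have [W [X [a [oW Wy sec Xy ay]]]] := reduced_dirac_section Du.
by exists W, X, a; split=> //; rewrite ay.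
Qed.

(** For w representing pi^* be' and w' in U over the same point, om(w, w') = be'(T pi w'); this no
    longer depends on the lifts. *)
Lemma pushed_form_relE y u be v r : Dred y (u, be) -> Hbar y v ->
  pushed_form_rel pi U om y u v r <-> r = ev be v.
Proof.
have value x w w' be' : sharp_rel x (tmap pi x *m be') w -> U x w' ->
    ev2 (om x) w w' = ev be' (w' *m tmap pi x).
  by move=> /sharp_relP[_ aw] [_ Hw']; rewrite -aw // /ev mulmxA.
move=> Du Hv; split=> [[x [w [w' [xy [Uw Uw'] uE vE ->]]]]|->].
  have [be' rel] := reduced_horizontal Uw; rewrite (value _ _ _ _ rel Uw') -vE.
  apply: reduced_value_unique Du Hv; apply/reduced_diracE.
  by exists x, w.
have [x [w [xy rel /= uE]]] := (reduced_diracE _ _).1 Du.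
have [x2 [w2 [x2y Uw2 vE]]] := Hv.
(* The lifts of u and v may sit at different points x and x2 of the fibre; the lift of v is
   translated to x. *)
have [g xE] : exists g, x = Psi g x2.
  by apply: quotient_fiber pi_quotient _ _ _; rewrite x2y.
have [be2 /(sharp_rel_act g) rel2] := reduced_horizontal Uw2.
have Uw2' : U (Psi g x2) (w2 *m tmap (Psi g) x2).
  exact: horizontal_of_pullback rel2.
have vE' : v = w2 *m tmap (Psi g) x2 *m tmap pi (Psi g x2).
  by rewrite -mulmxA tmap_act_quotient.
have Uw : U x w by exact: horizontal_of_pullback rel.
rewrite -xE in Uw2' vE'.
exists x, w, (w2 *m tmap (Psi g) x2); split=> //.
by rewrite (value _ _ _ _ rel Uw2') -vE'.
Qed.

Lemma dirac_formE y u be v : Dred y (u, be) -> Hbar y v ->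
  dirac_form Dred y u v = ev be v.
Proof.
move=> Du Hv; apply/(dirac_form_relE _ Du Hv).
have rel : (dirac_form_rel Dred y u v) (ev be v) by exact/(dirac_form_relE _ Du Hv).
exact: xgetPex (ex_intro _ _ rel).
Qed.

Lemma pushed_formE y u be v : Dred y (u, be) -> Hbar y v ->
  pushed_form pi U om y u v = ev be v.
Proof.
move=> Du Hv; apply/(pushed_form_relE _ Du Hv).
have rel : (pushed_form_rel pi U om y u v) (ev be v) by exact/(pushed_form_relE _ Du Hv).
exact: xgetPex (ex_intro _ _ rel).
Qed.

(* A covector c vanishing on V cap H is represented on H by a vector h of U,
   so that c(v) = om(h, v) = 0: hence v lies in V cap H. *)
Lemma horizontal_annihilator_radical x v : U x v ->
  (forall w, U x w -> ev2 (om x) v w = 0) -> V x v.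
Proof.
move=> [_ Hv] v0; have [r /(_ x)[Z [_ HVZ]]] := HV_rank.
suff : (H x `&` V x) v by case.
rewrite HVZ /= submxE; apply/eqP/rowP => j; rewrite [RHS]mxE.
(* The columns of [cokermx Z] vanish on V cap H and together cut it out. *)
pose c := col j (cokermx Z); have [Hh ch] := (sharp_relP _ _ _ _ _).1 (sharp_sharp x c).
have Uh : U x (sharp x c).
  split=> // w [Vw Hw]; rewrite -ch //.
  have : (H x `&` V x) w by split.
  rewrite HVZ /= => /submxP[l ->].
  by rewrite /ev /c colE -mulmxA (mulmxA Z) mulmx_coker mul0mx mulmx0 mxE.
have := ch v Hv; rewrite (ev2C _ _ (om_skew x)) v0 // oppr0 /ev /c colE mulmxA -colE.
by rewrite mxE.
Qed.

(** A lift of u to U is in the radical of om on U, hence vertical, so its image u under T pi is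
    zero. *)
Lemma dirac_form_nondegenerate y u : Hbar y u ->
  (forall v, Hbar y v -> dirac_form Dred y u v = 0) -> u = 0.
Proof.
move=> /reduced_HbarP[be Du] u0.
have [x [v0 [xy rel /= ->]]] := (reduced_diracE _ _).1 Du.
have Uv : U x v0 by exact: horizontal_of_pullback rel.
have : V x v0.
  apply: horizontal_annihilator_radical Uv _ => w Uw.
  have Hw : Hbar y (w *m tmap pi x) by exists x, w.
  have := u0 _ Hw; rewrite (dirac_formE Du Hw) /ev -mulmxA => <-.
  have [_ av] := (sharp_relP _ _ _ _ _).1 rel.
  by rewrite -av //; case: Uw.
by rewrite /V (vertical_ker Psi_action pi_quotient).
Qed.

End Reduction.

Section Pull2.
Context {R : realType} {l m n : nat}.
Context {L : manifold R l} {M : manifold R m} {N : manifold R n}.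

Lemma pull2_comp (F : L -> M) (K : M -> N) b x :
  smooth_map_at F x -> smooth_map_at K (F x) ->
  pull2 (K \o F) b x = pull2 F (pull2 K b) x.
Proof. by move=> sF sK; rewrite /pull2 tmap_comp // trmx_mul !mulmxA. Qed.

End Pull2.

(** * The constraint forms and the canonical form restricted to M *)

Section Mechanics.
Context {R : realType} {n k d : nat} {Q : manifold R n}.
Variables (S : mechanical_system Q k) (P : cotangent_bundle Q).
Variables (M : manifold R d) (i : M -> P).
Hypothesis i_smooth : smooth_map_on setT i.

Definition constraint_matrix (q : Q) : 'M[R]_(n, k) :=
  \matrix_(a, j) constraint_form S j q a 0.

Lemma mul_constraint_matrix q (u : 'rV[R]_n) j :
  (u *m constraint_matrix q) 0 j = ev (constraint_form S j q) u.
Proof. by rewrite /ev !mxE; apply: eq_bigr => a _; rewrite mxE. Qed.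

(** Its columns are the constraint forms pulled back to M along the inclusion and the projection to
    Q; it serves as theta in the reduction. *)
Definition horizontal_mx (m : M) : 'M[R]_(d, k) :=
  tmap i m *m (tmap (@cproj _ _ _ P) (i m) *m constraint_matrix (cproj (i m))).

Lemma horizontal_mxE m : horizontal S i m = [set v | v *m horizontal_mx m = 0].
Proof.
apply/seteqP; split=> v /=; rewrite /horizontal_mx !mulmxA => v0.
  by apply/rowP => j; rewrite mul_constraint_matrix [RHS]mxE; exact: v0.
by move=> j; rewrite -mul_constraint_matrix v0 mxE.
Qed.

Lemma near_inclusion_smooth (m : M) : \forall y \near m, smooth_map_at i y.
Proof. by apply: filterE => y; exact: i_smooth. Qed.

Lemma horizontal_mx_smooth m : smooth_cols m horizontal_mx.
Proof.
have sc : smooth_cols (cproj (i m)) constraint_matrix.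
  by apply: smooth_cols_stack => j; exact: constraint_form_smooth.
have sp : \forall y \near i m, smooth_map_at (@cproj _ _ _ P) y.
  by apply: filterE => y; exact: cproj_smooth.
exact: (smooth_pull1 (near_inclusion_smooth m) (smooth_pull1 sp sc)).
Qed.

Lemma pull2_omega_smooth m : smooth_tensor m (pull2 i (omega_can P)).
Proof. exact: (smooth_pull2 (near_inclusion_smooth m) (smooth_omega_can (i m))). Qed.

Lemma pull2_omega_skew m : (pull2 i (omega_can P) m)^T = - pull2 i (omega_can P) m.
Proof. by rewrite /pull2 trmx_mul trmxK trmx_mul omega_can_skew mulNmx mulmxN mulmxA. Qed.

End Mechanics.

Theorem proposition2 (R : realType) (n k dM dG dB : nat)
  (Q : manifold R n) (S : mechanical_system Q k) (P : cotangent_bundle Q)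
  (M : manifold R dM) (i : M -> P)
  (i_embedding : embedding i)
  (i_range : range i = constraint_submanifold S P)
  (omM := pull2 i (omega_can P))
  (H := horizontal S i)
  (H_subbundle : subbundle H)
  (H_nondegenerate : forall m u, H m u ->
     (forall v, H m v -> ev2 (omM m) u v = 0) -> u = 0)
  (D := assoc_dirac H omM)
  (G : lie_group R dG) (Phi : G -> P -> P)
  (Phi_action : smooth_action Phi)
  (Phi_symplectic : forall g p,
     pull2 (Phi g) (omega_can P) p = omega_can P p)
  (M_invariant : forall g, Phi g @` constraint_submanifold S P `<=`
                           constraint_submanifold S P)
  (Psi : G -> M -> M)
  (Psi_action : smooth_action Psi)
  (Psi_restr : forall g m, i (Psi g m) = Phi g (i m))
  (H_invariant : forall g m v, H m v -> H (Psi g m) (v *m tmap (Psi g) m))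
  (Psi_free : free_action Psi) (Psi_proper : proper_action Psi)
  (V := vertical Psi)
  (B : manifold R dB) (pi : M -> B) (pi_quotient : smooth_quotient Psi pi)
  (DK := fun m => D m `&` vert_Kperp (V m))
  (U := fun m => horizontal_annihilator (V m) (H m) (omM m))
  (Hbar := reduced_dist pi U)
  (omHbar := pushed_form pi U omM)
  (Dred := reduced_dirac pi V D)
  (HV_rank : constant_rank (fun m => H m `&` V m)) :
  (* (i) *)
  ((forall m, G0 D m = [set 0]) /\ (forall m, P1 D m = setT)) /\
  (* (ii) *)
  ((forall (W : set M) (X : M -> 'rV[R]_dM), open W -> smooth_vf W X ->
      (vf_section U W X <->
       exists2 a, form_section (fun m => annihilator (V m)) W a &
                  pont_section DK W X a)) /\
   ((forall m, [set v + h | v in V m & h in H m] = setT) ->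
    forall (W : set M) (X : M -> 'rV[R]_dM) a a',
      open W -> vf_section U W X ->
      form_section (fun m => annihilator (V m)) W a -> pont_section DK W X a ->
      form_section (fun m => annihilator (V m)) W a' -> pont_section DK W X a' ->
      forall m, W m -> a m = a' m)) /\
  (* (iii) *)
  ((forall y, G1 Dred y = Hbar y) /\ (forall y, G0 Dred y = [set 0])) /\
  (* (iv) *)
  ((forall (W : set M) a, open W ->
      form_section (fun m => annihilator (V m)) W a ->
      (exists2 X, vf_section U W X & pont_section D W X a) /\
      (forall X X', vf_section U W X -> pont_section D W X a ->
         vf_section U W X' -> pont_section D W X' a ->
         forall m, W m -> X m = X' m)) /\
   (forall m, [set z.2 | z in DK m] = annihilator (V m)) /\
   (forall y, P1 Dred y = setT)) /\
  (* (v) *)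
  (constant_rank (G1 Dred) ->
   (* the two 2-forms are well defined, *)
   ((forall y u v r, G1 Dred y u -> G1 Dred y v ->
       (dirac_form_rel Dred y u v r <-> r = dirac_form Dred y u v)) /\
    (forall y u v r, Hbar y u -> Hbar y v ->
       (pushed_form_rel pi U omM y u v r <-> r = omHbar y u v))) /\
   (* the first one is nondegenerate, and they coincide *)
   (forall y u, G1 Dred y u ->
      (forall v, G1 Dred y v -> dirac_form Dred y u v = 0) -> u = 0) /\
   (forall y u v, G1 Dred y u -> G1 Dred y v ->
      dirac_form Dred y u v = omHbar y u v)).

Proof.
have [i_smooth _ _ _] := i_embedding.
have om_smooth m : smooth_tensor m omM := pull2_omega_smooth i_smooth m.
have om_skew m : (omM m)^T = - omM m := pull2_omega_skew i m.
(* The inclusion i intertwines [Psi] and [Phi], so invariance of the canonical form pulls back to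
   M. *)
have om_invariant g m : pull2 (Psi g) omM m = omM m.
  have sPsi : smooth_map_at (Psi g) m := act_smooth Psi_action g m.
  have sPhi : smooth_map_at (Phi g) (i m) := act_smooth Phi_action g (i m).
  have si : smooth_map_at i m by exact: i_smooth.
  have siPsi : smooth_map_at i (Psi g m) by exact: i_smooth.
  have E : i \o Psi g = Phi g \o i by apply/funext => x; exact: Psi_restr.
  rewrite -(pull2_comp _ sPsi siPsi) E (pull2_comp _ si sPhi).
  by rewrite /omM /pull2 -[in RHS](Phi_symplectic g) /pull2.
have H_theta := horizontal_mxE S i.
have theta_smooth m := horizontal_mx_smooth S i_smooth m.
have DE m z : D m z <-> sharp_rel H omM m z.2 z.1.
  exact: assoc_diracE.
have pont_rel W X a m : pont_section D W X a -> W m -> sharp_rel H omM m (a m) (X m).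
  by move=> [_ _ DX] /DX /DE.
split; last split; last split; last split.
- split=> m; first exact: assoc_dirac_G0.
  exact: assoc_dirac_P1.
- split.
    move=> W X oW sX.
    exact: (section_horizontal_annihilator H_subbundle H_nondegenerate om_smooth
      om_skew theta_smooth H_theta Psi_action pi_quotient HV_rank oW sX).
  move=> VH W X a a' oW UX [_ aV] [_ _ DX] [_ aV'] [_ _ DX'] m Wm.
  have [/DE Da _] := DX m Wm; have [/DE Da' _] := DX' m Wm.
  exact: horizontal_form_unique (VH m) (aV m Wm) (aV' m Wm) Da Da'.
- split=> y; first exact: reduced_G1.
  exact: reduced_G0.
- split; last split.
  + move=> W a oW sa; split.
      have [UX DX] := sharp_vert_section H_subbundle H_nondegenerate om_smooth
        om_skew sa.
      by exists (fun m => sharp H omM m (a m)).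
    move=> X X' _ DX _ DX' m Wm.
    exact: sharp_rel_unique (pont_rel _ _ _ _ DX Wm) (pont_rel _ _ _ _ DX' Wm).
  + by move=> m; exact: proj_DK.
  + by move=> y; exact: reduced_P1.
(* All of (v) rests on one evaluation: for (u, be) in [Dred] and v in [Hbar], both forms take the
   value be(v). *)
- move=> _; have G1E y : G1 Dred y = Hbar y by exact: reduced_G1.
  have HbarP y w : Hbar y w <-> exists be, Dred y (w, be) by exact: reduced_HbarP.
  have dE y u be v : Dred y (u, be) -> Hbar y v -> dirac_form Dred y u v = ev be v.
    by move=> Du Hv; exact: dirac_formE Du Hv.
  have pE y u be v : Dred y (u, be) -> Hbar y v -> omHbar y u v = ev be v.
    by move=> Du Hv; exact: pushed_formE Du Hv.
  split; last split; first split.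
  + move=> y u v r; rewrite !G1E => /HbarP[be Du] Hv.
    by rewrite (dE _ _ _ _ Du Hv); exact: dirac_form_relE Du Hv.
  + move=> y u v r /HbarP[be Du] Hv.
    by rewrite (pE _ _ _ _ Du Hv); exact: pushed_form_relE Du Hv.
  + move=> y u; rewrite G1E => Hu u0.
    exact: dirac_form_nondegenerate Hu u0.
  + move=> y u v; rewrite !G1E => /HbarP[be Du] Hv.
    by rewrite (dE _ _ _ _ Du Hv) (pE _ _ _ _ Du Hv).
Qed.
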